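(* Let $\Gamma\le\operatorname{Isom}(X)$ be a countable discrete group acting on a proper CAT$(-1)$ space $X$, let $x\in X$, assume $0<\delta_X(\Gamma)<\infty$, and let a finite graph-of-groups hierarchy be rooted at $\Gamma$. At every nonterminal node $H\le\Gamma$, for every strongly connected component $C$ containing a directed cycle, every entry of the associated matrix $K_{C,x}(s)$ is finite at $s=\delta_X(\Gamma)$, and its spectral radius is at most one there. Every finite choice of hyperbolic representatives at every node gives a comparison matrix whose critical parameter is at most $\delta_X(\Gamma)$. If, in addition, $\Gamma$ is finitely generated and non-elementary with $\delta_X(\Gamma)<1$, or if the action is convex-cobounded, then all these critical parameters are bounded above by the single quantity $\dim_H(\Lambda_\Gamma,\rho_x)$.
   Context: $\delta_X(\Gamma)=\inf\{s>0:\sum_{g\in\Gamma}e^{-sd(x,gx)}<\infty\}$; $\Lambda_\Gamma$ is the limit set; $\rho_x(\xi,\eta)=e^{-(\xi\mid\eta)_x}$ is the Bourdon metric on $\partial X$. The action is convex-cobounded if there is $R<\infty$ with $\bigcup_{g,h\in\Gamma}[gx,hx]\subseteq\bigcup_{g\in\Gamma}gB_X(x,R)$ (the paper considers this for non-elementary properly discontinuous actions). A finite graph-of-groups hierarchy is a finite rooted tree of subgroups. Every nonterminal node $H$ carries a finite graph-of-groups decomposition (with fundamental group $H$), and selected vertex groups become its children. Matrix at a node $H$. Let $Y$ be the finite underlying graph and $T$ the Bass–Serre tree of the decomposition of $H$ ($H$ acts without inversions, $H\backslash T=Y$). For an oriented edge $f$ of $Y$: origin $\iota(f)$, terminus $t(f)$,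 reverse $\bar f$. Fix a base vertex $v_*$ of $Y$, a lift $\tilde v\in T$ of each vertex $v$, a lift $\tilde f$ of each oriented edge $f$ with origin $\widetilde{\iota(f)}$, and $\tau_f\in H$ with $t(\tilde f)=\tau_f\widetilde{t(f)}$, chosen so that $\widetilde{\bar f}=\tau_f^{-1}\overline{\tilde f}$ and $\tau_{\bar f}=\tau_f^{-1}$. Put $G_v=\operatorname{Stab}_H(\tilde v)$, $G_f=\operatorname{Stab}_H(\tilde f)\le G_{\iota(f)}$. For $c=rG_f\in G_{\iota(f)}/G_f$ let $L_{f,x}(c)=\min_{h\in G_f}d(x,rh\tau_fx)$. An allowed transition is a triple $(e,f,c)$ of oriented edges $e,f$ with $t(e)=\iota(f)$ and $c\in G_{\iota(f)}/G_f$, where $c\ne G_f$ is required if $f=\bar e$. Let $K_{ef,x}(s)=\sum_{c:(e,f,c)\text{ allowed}}e^{-sL_{f,x}(c)}$. A reduced coset-labelled loop based at $v_*$ is a sequence $(f_1,c_1;\dots;f_n,c_n)$, $c_j\in G_{\iota(f_j)}/G_{f_j}$, with $\iota(f_1)=v_*=t(f_n)$ and all $(f_j,f_{j+1},c_{j+1})$ allowed. The state set $E_*$ is the set of oriented edges occurring in some such loop. The components $C$ are strongly connected components of the support digraph of $K_x$ restricted to $E_*$; $K_{C,x}(s)$ is the diagonal block on $C$. Comparison matrices. An isometry $g$ is hyperbolic if $\tau_X(g)=\inf_zd(z,gz)$ is positive and attained; it has a unique axis $\operatorname{Ax}(g)$, and $a_x(g)=\tau_X(g)+2d(x,\operatorname{Ax}(g))$.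 A finite choice $\mathcal F$ of hyperbolic representatives in $C$ (a component containing a directed cycle) consists, for each $e,f\in C$, of a finite set $\mathcal F_{ef}$ of distinct cosets $c$ with $(e,f,c)$ allowed and, for each $c=rG_f\in\mathcal F_{ef}$, one hyperbolic element $g_{ef,c}=rh\tau_f$ with $h\in G_f$. The comparison matrix is $A^{\mathcal F}_{C,x}(s)_{ef}=\sum_{c\in\mathcal F_{ef}}e^{-sa_x(g_{ef,c})}$ and its critical parameter is $\inf\{s>0:\rho(A^{\mathcal F}_{C,x}(s))<1\}$, $\rho$ denoting spectral radius. *)

(* Defs.v *)
From HB Require Import structures.
From mathcomp Require Import all_boot all_order all_algebra.
From mathcomp Require Import all_classical all_reals all_analysis.
From mathcomp Require Import generic_quotient.
From mathcomp.real_closed Require Import complex.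

Set Implicit Arguments.
Unset Strict Implicit.
Unset Printing Implicit Defensive.
Import Order.TTheory GRing.Theory Num.Theory.
Import numFieldNormedType.Exports.

Local Open Scope quotient_scope.
Local Open Scope classical_set_scope.
Local Open Scope ring_scope.

Record isom {R : realType} (X : metricType R) := Isom {
  isom_fun :> X -> X;
  isom_inv : X -> X;
  isom_funK : cancel isom_fun isom_inv;
  isom_invK : cancel isom_inv isom_fun;
  isom_dist : forall y z, mdist (isom_fun y) (isom_fun z) = mdist y z }.

Section IsometryGroup.
Context {R : realType} {X : metricType R}.
Implicit Types g h k : isom X.

Lemma isomP g h : (g : X -> X) =1 h -> g = h.
Proof.
case: g h => [f f' fK f'K fd] [k k' kK k'K kd] /= /funext E; subst k.
have E' : f' = k' by apply/funext => y; rewrite -{1}(k'K y) fK.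
by subst k'; congr Isom; exact: Prop_irrelevance.
Qed.

Definition isom_one : isom X :=
  @Isom R X id id (fun=> erefl) (fun=> erefl) (fun _ _ => erefl).

Lemma isom_mul_dist g h y z :
  mdist ((g \o h) y) ((g \o h) z) = mdist y z.
Proof. by rewrite /= !isom_dist. Qed.

Definition isom_mul g h : isom X :=
  Isom (can_comp (isom_funK g) (isom_funK h))
       (can_comp (isom_invK h) (isom_invK g)) (isom_mul_dist g h).

Lemma isom_inv_dist g y z : mdist (isom_inv g y) (isom_inv g z) = mdist y z.
Proof. by rewrite -(isom_dist g) !isom_invK. Qed.

Definition isom_opp g : isom X :=
  Isom (isom_invK g) (isom_funK g) (isom_inv_dist g).

Lemma isom_mulA : associative isom_mul.
Proof. by move=> g h k; apply: isomP. Qed.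
Lemma isom_mul1 : left_id isom_one isom_mul.
Proof. by move=> g; apply: isomP. Qed.
Lemma isom_mul1r : right_id isom_one isom_mul.
Proof. by move=> g; apply: isomP. Qed.
Lemma isom_mulV : left_inverse isom_one isom_opp isom_mul.
Proof. by move=> g; apply: isomP => y /=; rewrite isom_funK. Qed.
Lemma isom_mulVr : right_inverse isom_one isom_opp isom_mul.
Proof. by move=> g; apply: isomP => y /=; rewrite isom_invK. Qed.

End IsometryGroup.

HB.instance Definition _ (R : realType) (X : metricType R) :=
  gen_eqMixin (isom X).
HB.instance Definition _ (R : realType) (X : metricType R) :=
  gen_choiceMixin (isom X).
HB.instance Definition _ (R : realType) (X : metricType R) :=
  isGroup.Build (isom X) isom_mulA isom_mul1 isom_mul1r isom_mulV isom_mulVr.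

Section Subgroups.
Context {G : groupType}.
Implicit Types H S : set G.

Definition subgroup H : Prop :=
  H 1%g /\ forall g h, H g -> H h -> H (g * h^-1)%g.

Definition finitely_generated H : Prop :=
  exists S, [/\ finite_set S, S `<=` H &
    forall K, subgroup K -> S `<=` K -> H `<=` K].

End Subgroups.

Section HyperbolicPlane.
Context {R : realType}.

Definition arcosh (u : R) : R := ln (u + Num.sqrt (u ^+ 2 - 1)).

(* Upper half-plane model, curvature -1. *)
Definition hplane : Type := {p : R * R | 0 < p.2}.

Definition hdist (p q : hplane) : R :=
  let: (a, b) := val p in let: (c, d) := val q in
  arcosh (1 + ((a - c) ^+ 2 + (b - d) ^+ 2) / (2 * b * d)).

End HyperbolicPlane.

Section Spaces.
Context {R : realType} (X : metricType R).

Definition proper_space : Prop :=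
  forall (y : X) (r : R), compact [set z | mdist y z <= r].

Definition geodesic (c : R -> X) (p q : X) : Prop :=
  [/\ c 0 = p, c (mdist p q) = q &
   forall s t, 0 <= s <= mdist p q -> 0 <= t <= mdist p q ->
     mdist (c s) (c t) = `|s - t|].

(* The union of all geodesic segments from p to q; in a CAT(-1) space there is
   exactly one. *)
Definition segment (p q : X) : set X :=
  [set y | exists c t, [/\ geodesic c p q, 0 <= t <= mdist p q & c t = y]].

(* Comparison of y on a side [p,q] and z on a side [p,r] with the comparison
   points y', z' in a comparison triangle p'q'r'.  As p, q, r are arbitrary this
   covers every pair of distinct sides; on a single side the comparison is an
   equality.  The points of the hyperbolic segment [p',q'] are those for which
   the triangle inequality through them is an equality. *)
Definition CAT_minus1 : Prop :=
  (forall p q : X, exists c, geodesic c p q) /\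
  forall p q r y z : X, segment p q y -> segment p r z ->
  forall p' q' r' y' z' : @hplane R,
    hdist p' q' = mdist p q -> hdist p' r' = mdist p r ->
    hdist q' r' = mdist q r ->
    hdist p' y' = mdist p y -> hdist y' q' = mdist y q ->
    hdist p' z' = mdist p z -> hdist z' r' = mdist z r ->
  mdist y z <= hdist y' z'.

End Spaces.

Record ray {R : realType} (X : metricType R) := Ray {
  ray_fun :> R -> X;
  ray_dist : forall s t, 0 <= s -> 0 <= t ->
    mdist (ray_fun s) (ray_fun t) = `|s - t| }.

HB.instance Definition _ (R : realType) (X : metricType R) :=
  gen_eqMixin (ray X).
HB.instance Definition _ (R : realType) (X : metricType R) :=
  gen_choiceMixin (ray X).

Section Boundary.
Context {R : realType} {X : metricType R}.

Definition asymptotic (c c' : ray X) : bool :=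
  `[< exists M : R, forall t, 0 <= t -> mdist (c t) (c' t) <= M >].

Lemma asymptotic_refl : reflexive asymptotic.
Proof. by move=> c; apply/asboolP; exists 0 => t _; rewrite mdistxx. Qed.

Lemma asymptotic_sym : symmetric asymptotic.
Proof.
move=> c c'; apply/asboolP/asboolP => -[M HM]; exists M => t t0;
  by rewrite metric_sym HM.
Qed.

Lemma asymptotic_trans : transitive asymptotic.
Proof.
move=> c' c c'' /asboolP[M HM] /asboolP[N HN]; apply/asboolP.
exists (M + N) => t t0.
by rewrite (le_trans (metric_triangle _ (c' t) _)) ?lerD ?HM ?HN.
Qed.

Definition asymptotic_equiv :=
  EquivRel asymptotic asymptotic_refl asymptotic_sym asymptotic_trans.

Definition boundary : Type := {eq_quot asymptotic_equiv}.

Definition gromov (x y z : X) : R :=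
  (mdist x y + mdist x z - mdist y z) / 2.

(* In a CAT(-1) space the limit exists and does not depend on the
   representatives; it is +oo when xi = eta. *)
Definition boundary_gromov (x : X) (xi eta : boundary) : \bar R :=
  lim ((gromov x ((repr xi : ray X) t) ((repr eta : ray X) t))%:E
         @[t --> +oo]).

Definition bourdon (x : X) (xi eta : boundary) : \bar R :=
  expeR (- boundary_gromov x xi eta).

Definition converges_to_boundary (x : X) (y : nat -> X) (xi : boundary) : Prop :=
  forall M : R, \forall n \near \oo & t \near +oo,
    M <= gromov x (y n) ((repr xi : ray X) t).

End Boundary.
Arguments boundary {R} X.

Section Hausdorff.
Context {R : realType} {Z : Type} (rho : Z -> Z -> \bar R).
Implicit Types A : set Z.

Definition diameter A : \bar R :=
  ereal_sup ([set 0%E] `|` [set rho p.1 p.2 | p in A `*` A]).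

Definition hausdorff_premeasure (s eps : R) A : \bar R :=
  ereal_inf [set (\sum_(0 <= i <oo) poweR (diameter (U i)) s)%E |
    U in [set U : nat -> set Z | A `<=` \bigcup_i U i /\
                                 forall i, (diameter (U i) <= eps%:E)%E]].

Definition hausdorff_measure (s : R) A : \bar R :=
  ereal_sup [set hausdorff_premeasure s eps A | eps in [set e | 0 < e]].

Definition hausdorff_dim A : \bar R :=
  ereal_inf [set s%:E | s in [set s | 0 < s /\ hausdorff_measure s A = 0%E]].

End Hausdorff.

Section IsometricActions.
Context {R : realType} {X : metricType R}.
Implicit Types (Gam : set (isom X)) (g : isom X) (x : X).

(* Discreteness as a subspace of the isometry group with the compact-open
   topology. *)
Definition discrete_subgroup Gam : Prop :=
  forall g, Gam g ->
    \forall f \near (isom_fun g : {compact-open, X -> X}),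
      forall h, Gam h -> isom_fun h = f -> h = g.

Definition critical_exponent Gam x : \bar R :=
  ereal_inf [set s%:E | s in [set s | 0 < s /\
    (\esum_(g in Gam) (expR (- (s * mdist x (g x))))%:E < +oo)%E]].

(* The limit set does not depend on the base point x. *)
Definition limit_set Gam x : set (boundary X) :=
  [set xi | exists g : nat -> isom X, (forall n, Gam (g n)) /\
              converges_to_boundary x (fun n => g n x) xi].

Definition nonelementary Gam x : Prop :=
  exists xi eta zeta, [/\ limit_set Gam x xi, limit_set Gam x eta,
    limit_set Gam x zeta & [/\ xi <> eta, eta <> zeta & xi <> zeta]].

(* Convex-coboundedness is only considered for non-elementary actions. *)
Definition convex_cobounded Gam x : Prop :=
  nonelementary Gam x /\
  exists r : R,
    \bigcup_(p in Gam `*` Gam) segment (p.1 x) (p.2 x) `<=`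
    \bigcup_(g in Gam) (isom_fun g @` ball x r).

Definition translation_length g : R := inf [set mdist z (g z) | z in setT].

Definition hyperbolic g : Prop :=
  0 < translation_length g /\ exists z, mdist z (g z) = translation_length g.

(* The union of all geodesic lines translated by g; for g hyperbolic there is
   exactly one. *)
Definition axis g : set X :=
  [set z | exists c : R -> X,
    [/\ forall s t, mdist (c s) (c t) = `|s - t|,
        forall t, g (c t) = c (t + translation_length g) & range c z]].

Definition axis_length x g : R :=
  translation_length g + 2 * inf [set mdist x z | z in axis g].

End IsometricActions.

(* Graphs in the sense of Serre, with oriented edges. *)
Record sgraph (V E : Type) := SGraph {
  org : E -> V;
  rev : E -> E;
  revK : involutive rev;
  rev_neq : forall e, rev e <> e }.

Section Graphs.
Variables (V E : Type) (Y : sgraph V E).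

Definition ter (e : E) : V := org Y (rev Y e).

Fixpoint edge_path (u : V) (p : seq E) (v : V) : Prop :=
  if p is e :: q then org Y e = u /\ edge_path (ter e) q v else u = v.

Fixpoint reduced (p : seq E) : Prop :=
  if p is e :: q then
    (if q is f :: _ then f <> rev Y e else True) /\ reduced q
  else True.

Definition is_tree : Prop :=
  [/\ inhabited V,
      forall u v, exists p, edge_path u p v &
      forall u p, edge_path u p u -> reduced p -> p = [::]].

End Graphs.

(* A finite graph-of-groups decomposition with fundamental group H, given by its
   Bass-Serre tree T = tree: H acts on T without inversions and the finite
   underlying graph quo is H \ T.  By the structure theorem of Bass-Serre theory
   this is the same datum; the vertex and edge groups are the stabilisers of
   lifts.  The maps actV and actE are only meaningful on elements of H. *)
Record decomposition (G : groupType) (H : set G) := Decomposition {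
  quoV : finType;
  quoE : finType;
  quo : sgraph quoV quoE;
  treeV : Type;
  treeE : Type;
  tree : sgraph treeV treeE;
  tree_is_tree : is_tree tree;
  actV : G -> treeV -> treeV;
  actE : G -> treeE -> treeE;
  actV1 : forall u, actV 1%g u = u;
  actE1 : forall e, actE 1%g e = e;
  actVM : forall g h u, H g -> H h -> actV (g * h)%g u = actV g (actV h u);
  actEM : forall g h e, H g -> H h -> actE (g * h)%g e = actE g (actE h e);
  act_org : forall g e, H g -> org tree (actE g e) = actV g (org tree e);
  act_rev : forall g e, H g -> rev tree (actE g e) = actE g (rev tree e);
  no_inversion : forall g e, H g -> actE g e <> rev tree e;
  projV : treeV -> quoV;
  projE : treeE -> quoE;
  proj_org : forall e, org quo (projE e) = projV (org tree e);
  proj_rev : forall e, rev quo (projE e) = projE (rev tree e);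
  projV_surj : forall v, exists u, projV u = v;
  projE_surj : forall f, exists e, projE e = f;
  projV_orbit : forall u v, projV u = projV v <-> exists2 g, H g & actV g u = v;
  projE_orbit : forall e f, projE e = projE f <-> exists2 g, H g & actE g e = f }.

Section VertexGroups.
Context {G : groupType} {H : set G} (D : decomposition H).

Definition stabV (u : treeV D) : set G := [set g | H g /\ actV g u = u].
Definition stabE (e : treeE D) : set G := [set g | H g /\ actE g e = e].

Record lifting := Lifting {
  base : quoV D;
  liftV : quoV D -> treeV D;
  liftE : quoE D -> treeE D;
  tau : quoE D -> G;
  liftVK : forall v, projV (liftV v) = v;
  liftEK : forall f, projE (liftE f) = f;
  lift_org : forall f, org (tree D) (liftE f) = liftV (org (quo D) f);
  tau_in : forall f, H (tau f);
  lift_ter : forall f,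
    ter (tree D) (liftE f) = actV (tau f) (liftV (ter (quo D) f));
  lift_rev : forall f,
    liftE (rev (quo D) f) = actE (tau f)^-1%g (rev (tree D) (liftE f));
  tau_rev : forall f, tau (rev (quo D) f) = (tau f)^-1%g }.

Variable F : lifting.

Definition vertex_group (v : quoV D) : set G := stabV (liftV F v).
Definition edge_group (f : quoE D) : set G := stabE (liftE F f).

Definition left_coset (r : G) (f : quoE D) : set G :=
  [set (r * h)%g | h in edge_group f].

Definition edge_cosets (f : quoE D) : set (set G) :=
  [set left_coset r f | r in vertex_group (org (quo D) f)].

Definition allowed (e f : quoE D) (c : set G) : Prop :=
  [/\ ter (quo D) e = org (quo D) f, edge_cosets f c &
      f = rev (quo D) e -> c <> edge_group f].

(* The loop (f_1,c_1; ...; f_n,c_n) is the nonempty sequence a :: l. *)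
Definition reduced_loop (a : quoE D * set G) (l : seq (quoE D * set G)) : Prop :=
  [/\ org (quo D) a.1 = base F, ter (quo D) (last a l).1 = base F,
      edge_cosets a.1 a.2 &
      path (fun b d => `[< allowed b.1 d.1 d.2 >]) a l].

Definition state (e : quoE D) : Prop :=
  exists a l, reduced_loop a l /\ e \in [seq b.1 | b <- a :: l].

(* The support of the transition matrix, restricted to the states: its (e,f)
   entry is a sum of positive terms over the c with allowed e f c. *)
Definition transition_digraph : rel (quoE D) :=
  fun e f => `[< [/\ state e, state f & exists c, allowed e f c] >].

Definition component (C : {set quoE D}) : Prop :=
  exists2 e, state e &
    C = [set f : quoE D | `[< state f >] && connect transition_digraph e f
                          && connect transition_digraph f e]%SET.

Definition has_cycle (C : {set quoE D}) : Prop :=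
  exists p : seq (quoE D),
    [/\ p != [::], all (fun e => e \in C) p & cycle transition_digraph p].

End VertexGroups.

(* Finite rooted trees of subgroups: at a nonterminal node the children are the
   stabilisers of chosen lifts u v of the selected vertices v. *)
Inductive hierarchy (G : groupType) : set G -> Type :=
| Terminal (H : set G) : hierarchy H
| Nonterminal (H : set G) (D : decomposition H) (sel : {set quoV D})
    (u : quoV D -> treeV D) (uK : forall v, projV (u v) = v)
    (children : forall v, v \in sel -> hierarchy (stabV (u v))) : hierarchy H.

Fixpoint every_nonterminal_node (G : groupType)
    (P : forall H : set G, decomposition H -> Prop)
    (H : set G) (t : hierarchy H) : Prop :=
  match t with
  | Terminal _ => True
  | Nonterminal H' D sel u _ children =>
      P H' D /\ forall v (vs : v \in sel), every_nonterminal_node P (children v vs)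
  end.

Section SpectralRadius.
Context {R : realType}.

Definition spectral_radius n (A : 'M[R]_n) : R :=
  sup [set ComplexField.Normc.normc l |
    l in [set l : R[i] | eigenvalue (map_mx (real_complex R) A) l]].

End SpectralRadius.

Section Matrices.
Context {R : realType} {X : metricType R} {H : set (isom X)}.
Context {D : decomposition H} (F : lifting D) (x : X).
Implicit Types (e f : quoE D) (c : set (isom X)) (C : {set quoE D}).

(* For c = r G_f, the elements r h with h in G_f are the elements of c.  The
   minimum is attained when the action is properly discontinuous. *)
Definition transition_length f c : R :=
  inf [set mdist x ((g * tau F f)%g x) | g in c].

Definition transition_entry (s : R) e f : \bar R :=
  \esum_(c in [set c | allowed F e f c])
    (expR (- (s * transition_length f c)))%:E.

(* The block of the transition matrix on C; used only when the entries are
   finite. *)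
Definition transition_block C (s : R) : 'M[R]_#|C| :=
  \matrix_(i, j) fine (transition_entry s (enum_val i) (enum_val j)).

Record hyperbolic_choice C := HyperbolicChoice {
  chosen : quoE D -> quoE D -> set (set (isom X));
  chosen_rep : quoE D -> quoE D -> set (isom X) -> isom X;
  chosen_finite : forall e f, e \in C -> f \in C -> finite_set (chosen e f);
  chosen_allowed : forall e f, e \in C -> f \in C ->
    chosen e f `<=` allowed F e f;
  chosen_hyperbolic : forall e f c, e \in C -> f \in C -> chosen e f c ->
    hyperbolic (chosen_rep e f c);
  chosen_repE : forall e f c, e \in C -> f \in C -> chosen e f c ->
    exists r h, [/\ vertex_group F (org (quo D) f) r, c = left_coset F r f,
      edge_group F f h & chosen_rep e f c = (r * h * tau F f)%g] }.

Definition comparison_matrix C (a : hyperbolic_choice C) (s : R) : 'M[R]_#|C| :=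
  \matrix_(i, j) \sum_(c \in chosen a (enum_val i) (enum_val j))
    expR (- (s * axis_length x (chosen_rep a (enum_val i) (enum_val j) c))).

Definition critical_parameter C (a : hyperbolic_choice C) : \bar R :=
  ereal_inf [set s%:E | s in
    [set s | 0 < s /\ spectral_radius (comparison_matrix a s) < 1]].

End Matrices.

(* Main.v *)
Require Import Defs.
From HB Require Import structures.
From mathcomp Require Import all_boot all_order all_algebra.
From mathcomp Require Import all_classical all_reals all_analysis.
From mathcomp Require Import generic_quotient ring lra.
From mathcomp.real_closed Require Import complex.

Set Implicit Arguments.
Unset Strict Implicit.
Unset Printing Implicit Defensive.
Import Order.TTheory GRing.Theory Num.Theory.
Import numFieldNormedType.Exports.

Local Open Scope quotient_scope.
Local Open Scope classical_set_scope.
Local Open Scope ring_scope.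

(** The proof has two independent parts: a comparison of matrices with the
    Poincare series, and the inequality delta <= dim_H of the limit set.

    Matrices.  An allowed path of coset labels multiplies out to an element of
    the node group.  The Bass-Serre tree shows that different paths between the
    same states give different elements, because such a path traces a reduced
    edge path in the tree, and reduced paths with the same ends coincide
    ([reduced_path_unique], [traces_cons], [words_uniq]).  As
    d(x, g h x) <= d(x, g x) + d(x, h x), the sum over all k of the entries of
    B^k is at most the Poincare series of Gamma at s, for every finite matrix B
    whose entries are sums of exp(- s d(x, g x)) over representatives of distinct
    labels ([power_series_le]).  For s > delta this is finite.
    - A comparison matrix is dominated by such a B, since
      d(x, g x) <= tau(g) + 2 d(x, Ax g); so its spectral radius is less than 1
      for every s > delta ([comparison_radius_lt1]).  The inequality requires the
      axis to be nonempty, which is proved from the comparison of midpoints.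
    - For a finite truncation of the transition matrix, summability forces the
      diagonal entries of the powers to be at most 1, a bound that survives
      s -> delta ([truncated_loop_le1]).  In a strongly connected component a
      fixed return path converts it into a bound on each entry, uniform over the
      truncations; so the full entries are finite at delta, their powers are
      bounded, and the spectral radius is at most 1.

    Dimension.  In both geometric cases of the last assertion the action is
    non-elementary, and the bound follows from the Bishop-Jones inequality
    delta <= dim_H ([critical_exponent_le_dim]), proved as follows.  Comparison triangles give
    Gromov hyperbolicity with an explicit constant.  Let s' < s < delta.  An
    ultrafilter of sets on which the Poincare series at s diverges determines a
    forward and a backward limit ray of the orbit.  A translate by a group element
    makes the two ends distinct, unless Gamma fixes the end; but then a second
    limit point would make this end conical, Gamma would act near it almost by
    translations, and delta would be 0 ([no_common_fixed_end]).  So there is a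
    set B with divergent series such that (g x | h^-1 x)_x is bounded for g, h in
    B ([divergent_transverse]).  Some annulus of radius n contains at least
    exp(s' (n + 1)) separated orbit points of B ([separated_annulus]).  Infinite
    words in these elements are quasi-geodesics with bounded backtracking, and
    converge to limit points whose Bourdon distances decay by at most
    exp(- (n + 1)) for each common letter ([word_gromov_le]).  A mass distribution
    argument on the tree of words then gives dimension at least s'
    ([hausdorff_dim_ge]). *)

(** * Comparison with the hyperbolic plane *)

Section HyperbolicFunctions.
Context {R : realType}.
Implicit Types t u : R.

Definition ch t : R := (expR t + expR (- t)) / 2.
Definition sh t : R := (expR t - expR (- t)) / 2.

Lemma expRNK t : expR t * expR (- t) = 1.
Proof. by rewrite expRxMexpNx_1. Qed.

Lemma ch_sh t : ch t ^+ 2 = 1 + sh t ^+ 2.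
Proof. rewrite /ch /sh; have := expRNK t; nra. Qed.

Lemma chN t : ch (- t) = ch t. Proof. by rewrite /ch opprK addrC. Qed.

Lemma chD t u : ch (t + u) = ch t * ch u + sh t * sh u.
Proof. by rewrite /ch /sh opprD !expRD; field. Qed.

Lemma chB t u : ch (t - u) = ch t * ch u - sh t * sh u.
Proof. by rewrite /ch /sh opprD !expRD !opprK; field. Qed.

Lemma ch_ge1 t : 1 <= ch t.
Proof.
have := expRNK t; have := expR_gt0 t; have := expR_gt0 (- t).
rewrite /ch; move: (expR t) (expR (- t)) => a b b0 a0 ab.
have : 0 <= (a - b) ^+ 2 by rewrite sqr_ge0.
nra.
Qed.

Lemma sh_ge0 t : 0 <= t -> 0 <= sh t.
Proof.
move=> t0; rewrite /sh divr_ge0// subr_ge0 ler_expR; lra.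
Qed.

Lemma sh_gt0 t : 0 < t -> 0 < sh t.
Proof. by move=> t0; rewrite /sh divr_gt0// subr_gt0 ltr_expR gtrN. Qed.

Lemma ler_sh t u : t <= u -> sh t <= sh u.
Proof.
move=> tu; rewrite /sh ler_pM2r// lerB// ler_expR//; lra.
Qed.

Lemma ler_ch t u : 0 <= t -> t <= u -> ch t <= ch u.
Proof.
move=> t0 tu; have t1 := ch_ge1 t; have u1 := ch_ge1 u.
have := ch_sh t; have := ch_sh u; have := ler_sh tu; have := sh_ge0 t0.
move=> s0 stu eu et; have {}stu : sh t ^+ 2 <= sh u ^+ 2 by nra.
by rewrite leNgt; apply/negP => ut; nra.
Qed.

Lemma ch_norm t : ch `|t| = ch t.
Proof. by case: (ger0P t) => // _; rewrite chN. Qed.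

Lemma ler_ch_inv t u : 0 <= u -> ch t <= ch u -> t <= u.
Proof.
move=> u0 tu; rewrite leNgt; apply/negP => ut.
have s : sh u < sh t.
  rewrite /sh; suff : expR u < expR t /\ expR (- t) < expR (- u) by lra.
  by rewrite !ltr_expR ltrN2.
have := ch_sh t; have := ch_sh u; have := sh_ge0 u0.
have := ch_ge1 t; have := ch_ge1 u; nra.
Qed.

Lemma arcosh_ch t : 0 <= t -> arcosh (ch t) = t.
Proof.
move=> t0; rewrite /arcosh ch_sh addrAC subrr add0r sqrtr_sqr ger0_norm ?sh_ge0//.
by rewrite (_ : ch t + sh t = expR t) ?expRK// /ch /sh; field.
Qed.

Lemma ch_arcosh u : 1 <= u -> ch (arcosh u) = u.
Proof.
move=> u1; rewrite /arcosh /ch.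
have := sqr_sqrtr (_ : 0 <= u ^+ 2 - 1); set v := Num.sqrt _ => /(_ _) vE.
have v0 : 0 <= v by rewrite sqrtr_ge0.
have {}vE : v ^+ 2 = u ^+ 2 - 1 by apply: vE; nra.
have uv : 0 < u + v by lra.
rewrite expRN lnK ?posrE// -[RHS](mulfK (_ : 2 != 0 :> R))//.
congr (_ / _); have -> : (u + v)^-1 = u - v.
  apply: (mulfI (lt0r_neq0 uv)); rewrite mulfV ?lt0r_neq0//; nra.
ring.
Qed.

End HyperbolicFunctions.

Section PolarCoordinates.
Context {R : realType}.
Implicit Types r c s t : R.

Lemma polar_den_gt0 r c s : c ^+ 2 + s ^+ 2 = 1 -> 0 < ch r - sh r * c.
Proof.
move=> cs; have := ch_sh r; have := ch_ge1 r; nra.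
Qed.

Lemma polar_snd_gt0 r c s (cs : c ^+ 2 + s ^+ 2 = 1) :
  0 < (sh r * s / (ch r - sh r * c), (ch r - sh r * c)^-1).2.
Proof. by rewrite /= invr_gt0 (polar_den_gt0 _ cs). Qed.

(** The half-plane image of the hyperboloid point
    (ch r, c sh r, s sh r), at distance r from i in the direction (c, s). *)
Definition polar r c s (cs : c ^+ 2 + s ^+ 2 = 1) : @hplane R :=
  exist (fun p : R * R => 0 < p.2) _ (polar_snd_gt0 r cs).

(** The Minkowski form of two hyperboloid points is the argument of [arcosh]
    in the half-plane distance. *)
Lemma hdist_polar r c s (cs : c ^+ 2 + s ^+ 2 = 1)
    r' c' s' (cs' : c' ^+ 2 + s' ^+ 2 = 1) :
  hdist (polar r cs) (polar r' cs') =
  arcosh (ch r * ch r' - sh r * sh r' * (c * c' + s * s')).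
Proof.
rewrite /hdist /=; congr arcosh.
have := polar_den_gt0 r cs; have := polar_den_gt0 r' cs'.
have E : ch r ^+ 2 - (sh r * c) ^+ 2 = 1 + (sh r * s) ^+ 2.
  have := ch_sh r; have -> : (sh r * s) ^+ 2 = sh r ^+ 2 * (1 - c ^+ 2).
    by rewrite -cs; ring.
  by move=> ->; ring.
have E' : ch r' ^+ 2 - (sh r' * c') ^+ 2 = 1 + (sh r' * s') ^+ 2.
  have := ch_sh r'; have -> : (sh r' * s') ^+ 2 = sh r' ^+ 2 * (1 - c' ^+ 2).
    by rewrite -cs'; ring.
  by move=> ->; ring.
have -> : sh r * sh r' * (c * c' + s * s') =
          (sh r * c) * (sh r' * c') + (sh r * s) * (sh r' * s') by ring.
move: E E'; set p1 := sh r * c; set p2 := sh r * s; set p0 := ch r.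
set q1 := sh r' * c'; set q2 := sh r' * s'; set q0 := ch r' => E E' w'0 w0.
have sq_diff (a b w : R) : a - b = w -> 0 < w -> forall m,
    a ^+ 2 - b ^+ 2 = m -> a = (m / w + w) / 2 /\ b = (m / w - w) / 2.
  move=> <- wp m <-; have d0 : a - b != 0 by rewrite lt0r_neq0.
  by split; field.
have [] := sq_diff p0 p1 _ erefl w0 _ E.
have [] := sq_diff q0 q1 _ erefl w'0 _ E'.
move: w0 w'0; move: (p0 - p1) (q0 - q1) => w w' w0 w'0 -> -> -> ->.
by field; rewrite !lt0r_neq0.
Qed.

End PolarCoordinates.

Section Comparison.
Context {R : realType} (X : metricType R) (X_cat : CAT_minus1 X).
Implicit Types (p q r y z : X) (t u : R).

Lemma mdist_ler_dist p q r : `|mdist p q - mdist p r| <= mdist q r.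
Proof.
have := metric_triangle p q r; have := metric_triangle p r q.
rewrite (metric_sym r q) ler_norml; lra.
Qed.

Lemma geodesic_dist (c : R -> X) p q t : geodesic c p q -> 0 <= t <= mdist p q ->
  mdist p (c t) = t /\ mdist (c t) q = mdist p q - t.
Proof.
case=> c0 c1 cE /andP[t0 t1]; have D : 0 <= mdist p q by apply: mdist_ge0.
split.
- by rewrite -{1}c0 cE ?lexx ?t0// sub0r normrN ger0_norm.
- by rewrite -{1}c1 cE ?lexx ?D ?t0// ler0_norm; lra.
Qed.

(** The law of cosines in the comparison triangle, which is placed with the
    vertex for [p] at the origin of polar coordinates; [k] is the cosine of the
    angle there, so the second coordinate of its unit vector is sqrt(1 - k^2). *)
Lemma cat_cosine p q r (c c' : R -> X) t u :
  geodesic c p q -> geodesic c' p r -> 0 < mdist p q -> 0 < mdist p r ->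
  0 <= t <= mdist p q -> 0 <= u <= mdist p r ->
  let k := (ch (mdist p q) * ch (mdist p r) - ch (mdist q r)) /
           (sh (mdist p q) * sh (mdist p r)) in
  -1 <= k <= 1 /\ ch (mdist (c t) (c' u)) <= ch t * ch u - sh t * sh u * k.
Proof.
move=> gc gc' a0 b0 tq ur k.
have sa := sh_gt0 a0; have sb := sh_gt0 b0.
have sab : 0 < sh (mdist p q) * sh (mdist p r) by rewrite mulr_gt0.
have k1 : -1 <= k <= 1.
  rewrite /k ler_pdivlMr// ler_pdivrMr//.
  have := mdist_ler_dist p q r => /(ler_ch (normr_ge0 _)).
  rewrite ch_norm chB => lb.
  have := metric_triangle q p r; rewrite (metric_sym q p).
  by move=> /(ler_ch (mdist_ge0 _ _)); rewrite chD; lra.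
split=> //.
have [k_1 k_2] := andP k1.
have k2 : 0 <= 1 - k ^+ 2 by nra.
have unit0 : 1 ^+ 2 + 0 ^+ 2 = 1 :> R by ring.
have unitk : k ^+ 2 + Num.sqrt (1 - k ^+ 2) ^+ 2 = 1 by rewrite sqr_sqrtr//; ring.
have kE : sh (mdist p q) * sh (mdist p r) * k =
          ch (mdist p q) * ch (mdist p r) - ch (mdist q r).
  by rewrite /k mulrC mulfVK// lt0r_neq0.
have sh00 : sh 0 = 0 :> R by rewrite /sh oppr0 subrr mul0r.
have ch00 : ch 0 = 1 :> R by rewrite /ch oppr0 expR0; field.
have [t0 t1] := andP tq; have [u0 u1] := andP ur.
have [ct1 ct2] := geodesic_dist gc tq.
have [cu1 cu2] := geodesic_dist gc' ur.
have D v w (vw : v ^+ 2 + w ^+ 2 = 1) s s' : 0 <= s -> s <= s' ->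
    hdist (polar s vw) (polar s' vw) = s' - s.
  move=> s0 ss'; rewrite hdist_polar -!expr2 vw mulr1.
  by rewrite -(arcosh_ch (_ : 0 <= s' - s)) ?subr_ge0// chB mulrC [in X in _ - X]mulrC.
have h0E v w (vw : v ^+ 2 + w ^+ 2 = 1) s : 0 <= s ->
    hdist (polar 0 unit0) (polar s vw) = s.
  by move=> s0; rewrite hdist_polar ch00 sh00 !mul0r subr0 mul1r arcosh_ch.
have Q1 : 1 <= ch t * ch u - sh t * sh u * k.
  have := ch_ge1 (t - u); rewrite chB.
  have : sh t * sh u * k <= sh t * sh u by rewrite ler_piMr// mulr_ge0// sh_ge0.
  by lra.
rewrite -[leRHS](ch_arcosh Q1); apply: ler_ch; first exact: mdist_ge0.
have -> : ch t * ch u - sh t * sh u * k =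
  ch t * ch u - sh t * sh u * (1 * k + 0 * Num.sqrt (1 - k ^+ 2)) by ring.
rewrite -(hdist_polar t unit0 u unitk).
have segq : segment p q (c t) by exists c, t.
have segr : segment p r (c' u) by exists c', u.
apply: (X_cat.2 _ _ _ _ _ segq segr (polar 0 unit0) (polar (mdist p q) unit0)
  (polar (mdist p r) unitk)).
- by rewrite h0E// ltW.
- by rewrite h0E// ltW.
- rewrite hdist_polar (_ : sh _ * _ * _ = sh (mdist p q) * sh (mdist p r) * k); last by ring.
  rewrite kE (_ : _ - (_ - _) = ch (mdist q r)); last by ring.
  by rewrite arcosh_ch// mdist_ge0.
- by rewrite h0E// ct1.
- by rewrite D.
- by rewrite h0E// cu1.
- by rewrite D.
Qed.

Lemma expR1_ge2 : 2 <= expR (1 : R).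
Proof. by have := expR_ge1Dx (1 : R); lra. Qed.

(** For t <= 1 the triangle inequality suffices.  For t > 1 the law of cosines
    gives ch d(c t, c' t) <= 1 + sh(t)^2 (1 - k), where 1 - k is at most
    ch d(q,r) / (sh d(p,q) sh d(p,r)) and so of order exp(- 2 (q|r)_p), all the
    lengths involved being at least 1; this yields ch d <= 5. *)
Lemma thin_triangle p q r (c c' : R -> X) t :
  geodesic c p q -> geodesic c' p r -> 0 <= t -> t <= gromov p q r ->
  mdist (c t) (c' t) <= 9.
Proof.
move=> gc gc' t0; rewrite /gromov => tg.
have tq : t <= mdist p q by have := metric_triangle p q r; lra.
have tr : t <= mdist p r.
  by have := metric_triangle p r q; rewrite (metric_sym r q); lra.
have [ct1 _] := geodesic_dist gc (introT andP (conj t0 tq)).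
have [cu1 _] := geodesic_dist gc' (introT andP (conj t0 tr)).
have [t1|t1] := leP t 1.
  have := metric_triangle (c t) p (c' t); rewrite (metric_sym (c t) p) ct1 cu1; lra.
have pq0 : 0 < mdist p q by lra.
have pr0 : 0 < mdist p r by lra.
have [/andP[k1 k2] /=] := cat_cosine gc gc' pq0 pr0 (introT andP (conj t0 tq))
  (introT andP (conj t0 tr)).
set k := (X in _ - _ * X).
set a := mdist p q in tg tq k *; set b := mdist p r in tg tr k *.
set d := mdist q r in tg k *.
have sa : expR a / 4 <= sh a.
  rewrite /sh; have := expRNK a.
  have : expR 1 <= expR a by rewrite ler_expR; lra.
  have := expR1_ge2; have := expR_gt0 (- a); nra.
have sb : expR b / 4 <= sh b.
  rewrite /sh; have := expRNK b.
  have : expR 1 <= expR b by rewrite ler_expR; lra.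
  have := expR1_ge2; have := expR_gt0 (- b); nra.
have ea := expR_gt0 a; have eb := expR_gt0 b.
have sab : 0 < sh a * sh b by apply: mulr_gt0; lra.
have kE : sh a * sh b * (1 - k) = ch d - ch (a - b).
  by rewrite mulrBr mulr1 [X in _ - X]mulrC /k mulfVK ?lt0r_neq0// chB; ring.
have chd : ch d <= expR d.
  rewrite /ch; have : expR (- d) <= expR d.
    by rewrite ler_expR; have := mdist_ge0 q r; rewrite -/d; lra.
  lra.
have st : sh t <= expR t / 2 by rewrite /sh; have := expR_gt0 (- t); lra.
have st0 := sh_ge0 t0.
have et : expR t ^+ 2 * expR d <= expR a * expR b.
  by rewrite expr2 -!expRD ler_expR; lra.
have bound : sh t ^+ 2 * (1 - k) <= 4.
  rewrite -(ler_pM2l sab) mulrCA kE.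
  have s4 : sh t ^+ 2 <= expR t ^+ 2 / 4 by nra.
  have ch1 := ch_ge1 (a - b).
  have t2 : 0 <= sh t ^+ 2 by rewrite sqr_ge0.
  have : sh t ^+ 2 * (ch d - ch (a - b)) <= expR t ^+ 2 / 4 * expR d.
    have ed := expR_gt0 d.
    have : sh t ^+ 2 * expR d <= expR t ^+ 2 / 4 * expR d by rewrite ler_pM2r.
    have : sh t ^+ 2 * (ch d - ch (a - b)) <= sh t ^+ 2 * expR d.
      by apply: ler_wpM2l => //; lra.
    lra.
  have : expR a / 4 * (expR b / 4) <= sh a * sh b.
    by apply: ler_pM => //; lra.
  lra.
move=> cD; have {}cD : ch (mdist (c t) (c' t)) <= 5.
  apply: (le_trans cD); have := ch_sh t.
  rewrite -!expr2; lra.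
apply: ler_ch_inv => //; apply: (le_trans cD).
have := expR_ge1Dx (9 : R); have := expR_gt0 (- 9 : R); rewrite /ch; lra.
Qed.

End Comparison.

(** * Axes of hyperbolic isometries *)

Section Isometries.
Context {R : realType} {X : metricType R}.
Implicit Types (g h : isom X) (y z : X).

Lemma isomM g h y : (g * h)%g y = g (h y). Proof. by []. Qed.
Lemma isom1 y : (1%g : isom X) y = y. Proof. by []. Qed.
Lemma isomK g y : (g^-1)%g (g y) = y. Proof. exact: isom_funK. Qed.
Lemma isomVK g y : g ((g^-1)%g y) = y. Proof. exact: isom_invK. Qed.
Lemma isomXS g n y : (g ^+ n.+1)%g y = g ((g ^+ n)%g y).
Proof. by rewrite expgS. Qed.
Lemma isomXSr g n y : (g ^+ n.+1)%g y = (g ^+ n)%g (g y).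
Proof. by rewrite expgSr. Qed.
Lemma isomXD g m n y : (g ^+ (m + n))%g y = (g ^+ m)%g ((g ^+ n)%g y).
Proof. by rewrite expgnDr. Qed.

Lemma geodesic_rev (c : R -> X) p q : geodesic c p q ->
  geodesic (fun t => c (mdist p q - t)) q p.
Proof.
case=> c0 c1 cE; split; rewrite ?subr0// (metric_sym q p) ?subrr//.
move=> s t s01 t01; rewrite cE; [|lra|lra].
by rewrite -normrN; congr `|_|; ring.
Qed.

Lemma geodesic_isom g (c : R -> X) p q : geodesic c p q ->
  geodesic (g \o c) (g p) (g q).
Proof.
case=> c0 c1 cE; split; rewrite /= ?isom_dist ?c0 ?c1//.
by move=> s t s01 t01; rewrite isom_dist cE.
Qed.

End Isometries.

Section HyperbolicAxis.
Context {R : realType} (X : metricType R) (X_cat : CAT_minus1 X).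
Implicit Types (g h : isom X) (y z : X) (s t : R).

(** For the midpoints at distance D, with d = d(q,r) and
    m = sh(a)^2 (1 - k) <= 2 sh(a)^2, the law of cosines gives ch(D) <= 1 + m
    and ch(d) = 1 + 4 m ch(a)^2.  Hence
    sh(D)^2 <= m (2 + m) <= 2 m ch(a)^2 = sh(d/2)^2. *)
Lemma midpoints_isosceles p q r (c c' : R -> X) a :
  geodesic c p q -> geodesic c' p r -> 0 < a ->
  mdist p q = 2 * a -> mdist p r = 2 * a ->
  2 * mdist (c a) (c' a) <= mdist q r.
Proof.
move=> gc gc' a0 pq pr.
have pq0 : 0 < mdist p q by lra.
have pr0 : 0 < mdist p r by lra.
have aq : 0 <= a <= mdist p q by lra.
have ar : 0 <= a <= mdist p r by lra.
have [/andP[k_ge _] /=] := cat_cosine X_cat gc gc' pq0 pr0 aq ar.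
rewrite pq pr in k_ge *.
move: k_ge; set k := (X in - 1 <= X) => k_ge cD.
have s2a : sh (2 * a) = 2 * sh a * ch a.
  by rewrite /sh /ch (_ : 2 * a = a + a) ?opprD ?expRD; [field|ring].
have c2 u : ch (2 * u) = 1 + 2 * sh u ^+ 2.
  by rewrite (_ : 2 * u = u + u) ?chD -?expr2 ?ch_sh; ring.
have sa := sh_gt0 a0; have ca := ch_ge1 a.
have kE : sh (2 * a) ^+ 2 * (1 - k) = ch (mdist q r) - 1.
  have s2 : 0 < sh (2 * a) * sh (2 * a) by apply: mulr_gt0; apply: sh_gt0; lra.
  rewrite mulrBr mulr1 [X in _ - X]mulrC /k expr2 mulfVK ?lt0r_neq0//.
  by have := ch_sh (2 * a); rewrite !expr2; lra.
set D := mdist (c a) (c' a) in cD *; set d := mdist q r in kE *.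
have d0 : 0 <= d by exact: mdist_ge0.
have D0 : 0 <= D by exact: mdist_ge0.
apply: ler_ch_inv => //; rewrite c2.
suff : 2 * sh D ^+ 2 <= sh (2 * a) ^+ 2 * (1 - k) by lra.
have cD1 := ch_ge1 D; have eD := ch_sh D; have ea := ch_sh a.
have k1 : 0 <= 1 - k.
  have : 0 <= sh (2 * a) ^+ 2 * (1 - k) by rewrite kE; have := ch_ge1 d; lra.
  by rewrite pmulr_rge0// exprn_gt0// sh_gt0//; lra.
have k2 : ch a * ch a - sh a * sh a * k = 1 + sh a ^+ 2 * (1 - k).
  by rewrite -expr2 ea; ring.
rewrite k2 in cD; rewrite s2a.
have kle2 : 1 - k <= 2 by lra.
set m := sh a ^+ 2 * (1 - k) in cD *.
have m0 : 0 <= m by rewrite mulr_ge0// sqr_ge0.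
have -> : (2 * sh a * ch a) ^+ 2 * (1 - k) = 4 * m * ch a ^+ 2.
  by rewrite /m; ring.
have mle : m <= 2 * sh a ^+ 2 by rewrite /m; have := sqr_ge0 (sh a); nra.
have : sh D ^+ 2 <= (1 + m) ^+ 2 - 1 by nra.
rewrite ea; nra.
Qed.

(** [h] carries the midpoint of [y, h y] to the midpoint of [h y, h^2 y]; these
    are at least [L] and at most half of d(y, h^2 y) apart. *)
Lemma displacement_double h L : 0 < L -> (forall y, L <= mdist y (h y)) ->
  forall y, 2 * L <= mdist y (h (h y)).
Proof.
move=> L0 hL y; have [c gc] := X_cat.1 y (h y).
have D0 : 0 < mdist y (h y) by have := hL y; lra.
have a0 : 0 < mdist y (h y) / 2 by lra.
have dE : mdist (h y) y = 2 * (mdist y (h y) / 2) by rewrite metric_sym; field.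
have dE' : mdist (h y) (h (h y)) = 2 * (mdist y (h y) / 2).
  by rewrite isom_dist; field.
have := midpoints_isosceles (geodesic_rev gc) (geodesic_isom h gc) a0 dE dE'.
rewrite /= (_ : mdist y (h y) - _ = mdist y (h y) / 2); last by field.
by apply: le_trans; rewrite ler_pM2l.
Qed.

Lemma displacement_pow2 h L k : 0 < L -> (forall y, L <= mdist y (h y)) ->
  forall y, 2 ^+ k * L <= mdist y ((h ^+ (2 ^ k))%g y).
Proof.
move=> L0 hL; elim: k => [|k IHk] y; first by rewrite mul1r expg1.
have := displacement_double _ IHk y => /(_ _).
rewrite exprS -mulrA expnS mul2n -addnn isomXD; apply.
by rewrite mulr_gt0// exprn_gt0.
Qed.

Lemma translation_length_le g y : translation_length g <= mdist y (g y).
Proof.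
apply: ge_inf; last by exists y.
by exists 0 => _ [z _ <-]; apply: mdist_ge0.
Qed.

Section Axis.
Variables (g : isom X) (z : X).
Let L := translation_length g.
Hypotheses (L0 : 0 < L) (zL : mdist z (g z) = L).

Lemma orbit_dist_le n : mdist z ((g ^+ n)%g z) <= n%:R * L.
Proof.
elim: n => [|n IHn]; first by rewrite mdistxx mul0r.
rewrite isomXSr -natr1 mulrDl mul1r.
apply: le_trans (metric_triangle _ ((g ^+ n)%g z) _) _.
by rewrite lerD// isom_dist zL.
Qed.

(** The displacement of g^(2^k) is at least 2^k L everywhere, which leaves no
    room for the shorter powers. *)
Lemma orbit_dist n : mdist z ((g ^+ n)%g z) = n%:R * L.
Proof.
apply/eqP; rewrite eq_le orbit_dist_le/=.
have n2 : (n <= 2 ^ n)%N by apply: ltnW; exact: ltn_expl.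
have := @displacement_pow2 g L n L0 (@translation_length_le g) z.
have := metric_triangle z ((g ^+ n)%g z) ((g ^+ (2 ^ n))%g z).
rewrite -{2}(subnKC n2) isomXD isom_dist.
have := orbit_dist_le (2 ^ n - n); rewrite natrB// natrX; lra.
Qed.

Lemma orbit_distD m n : mdist ((g ^+ m)%g z) ((g ^+ (m + n))%g z) = n%:R * L.
Proof. by rewrite isomXD isom_dist orbit_dist. Qed.

Variable c : R -> X.
Hypothesis gc : geodesic c z (g z).

(* The translates of the segment from z to g z, run through one after another. *)
Let r t := (g ^+ Num.truncn (t / L))%g (c (t - (Num.truncn (t / L))%:R * L)).

Let trunc_bound t : 0 <= t ->
  (Num.truncn (t / L))%:R * L <= t < ((Num.truncn (t / L)).+1)%:R * L.
Proof.
move=> t0; rewrite -ler_pdivlMr// -ltr_pdivrMr//.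
by apply: truncn_itv; rewrite divr_ge0// ltW.
Qed.

Let r_shift t : 0 <= t -> r (t + L) = g (r t).
Proof.
move=> t0; have /andP[t1 t2] := trunc_bound t0.
have tE : Num.truncn ((t + L) / L) = (Num.truncn (t / L)).+1.
  rewrite mulrDl mulfV ?lt0r_neq0//; apply: truncn_def.
  rewrite -!natr1 in t2 *; rewrite lerD2r ltrD2r ler_pdivlMr// ltr_pdivrMr// t1/=.
  exact: t2.
by rewrite /r tE isomXS -natr1; congr (g (_ (c _))); ring.
Qed.

Let r_dist_le s t : 0 <= s -> s <= t -> mdist (r s) (r t) = t - s.
Proof.
move=> s0 st; have t0 : 0 <= t := le_trans s0 st.
have := trunc_bound s0; have := trunc_bound t0; rewrite /r.
have mn : (Num.truncn (s / L) <= Num.truncn (t / L))%N.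
  by apply: le_truncn; rewrite ler_pM2r// invr_gt0.
move: mn; move: (Num.truncn (s / L)) (Num.truncn (t / L)) => m n mn.
rewrite -!natr1 !mulrDl !mul1r => /andP[t1 t2] /andP[s1 s2].
have sm : 0 <= s - m%:R * L <= mdist z (g z) by rewrite zL; lra.
have tn : 0 <= t - n%:R * L <= mdist z (g z) by rewrite zL; lra.
have [a1 a2] := geodesic_dist gc sm; have [b1 b2] := geodesic_dist gc tn.
move: a2 b2; rewrite zL => a2 b2.
set p := (g ^+ m)%g (c _); set q := (g ^+ n)%g (c _).
have Hp : mdist ((g ^+ m)%g z) p = s - m%:R * L by rewrite isom_dist.
have Hq : mdist q ((g ^+ n.+1)%g z) = L - (t - n%:R * L).
  by rewrite isomXSr isom_dist.
apply/eqP; rewrite eq_le; apply/andP; split; last first.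
  have := orbit_distD m (n.+1 - m); rewrite subnKC; last exact: leqW.
  rewrite natrB; last exact: leqW.
  rewrite -natr1.
  have := metric_triangle ((g ^+ m)%g z) p ((g ^+ n.+1)%g z).
  have := metric_triangle p q ((g ^+ n.+1)%g z); rewrite Hp Hq.
  by rewrite mulrBl mulrDl mul1r; lra.
move: mn; rewrite leq_eqVlt => /orP[/eqP mnE|mn].
  rewrite /p /q -mnE isom_dist; have [_ _ ->] := gc; rewrite ?zL.
  - by rewrite mnE ler0_norm; lra.
  - lra.
  - by rewrite mnE; lra.
have Hp' : mdist p ((g ^+ m.+1)%g z) = L - (s - m%:R * L).
  by rewrite isomXSr isom_dist.
have Hq' : mdist ((g ^+ n)%g z) q = t - n%:R * L by rewrite isom_dist.
have := orbit_distD m.+1 (n - m.+1); rewrite subnKC// natrB//.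
have := metric_triangle p ((g ^+ m.+1)%g z) q.
have := metric_triangle ((g ^+ m.+1)%g z) ((g ^+ n)%g z) q; rewrite Hp' Hq'.
by rewrite -natr1 mulrBl mulrDl mul1r; lra.
Qed.

Let r_dist s t : 0 <= s -> 0 <= t -> mdist (r s) (r t) = `|s - t|.
Proof.
move=> s0 t0; case: (leP s t) => st.
  by rewrite r_dist_le// ler0_norm; lra.
by rewrite metric_sym (r_dist_le t0 (ltW st)) gtr0_norm; lra.
Qed.

Let r_shiftn n t : 0 <= t -> r (t + n%:R * L) = (g ^+ n)%g (r t).
Proof.
move=> t0; elim: n => [|n IHn]; first by rewrite mul0r addr0.
have tn : 0 <= t + n%:R * L by rewrite addr_ge0// mulr_ge0// ltW.
by rewrite isomXS -IHn -(r_shift tn) -natr1; congr r; ring.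
Qed.

(* [r] is defined for nonnegative times only; translating back by a large power
   of [g] extends it to a line. *)
Let shift t := (Num.truncn (`|t| / L)).+1.
Let line t := ((g ^+ shift t)^-1)%g (r (t + (shift t)%:R * L)).

Let shift_ge0 n t : (shift t <= n)%N -> 0 <= t + n%:R * L.
Proof.
move=> sn; have /andP[_ tL] := trunc_bound (normr_ge0 t).
have : (shift t)%:R * L <= n%:R * L by rewrite ler_pM2r// ler_nat.
by move: tL; rewrite -/(shift t); have := ler_norm (- t); rewrite normrN; lra.
Qed.

Let lineE n t : (shift t <= n)%N -> line t = ((g ^+ n)^-1)%g (r (t + n%:R * L)).
Proof.
move=> sn; rewrite /line -(subnK sn); set k := (n - shift t)%N.
have -> : t + (k + shift t)%:R * L = t + (shift t)%:R * L + k%:R * L.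
  by rewrite natrD; ring.
rewrite (r_shiftn _ (shift_ge0 (leqnn _))) expgnDr invgM isomM.
by rewrite isomK.
Qed.

Lemma axis_nonempty_aux : axis g !=set0.
Proof.
exists (line 0), line; split; last by exists 0.
- move=> s t; set n := maxn (shift s) (shift t).
  rewrite (lineE (leq_maxl _ _ : shift s <= n)%N).
  rewrite (lineE (leq_maxr _ _ : shift t <= n)%N) isom_dist r_dist.
  + by congr `|_|; ring.
  + by apply: shift_ge0; exact: leq_maxl.
  + by apply: shift_ge0; exact: leq_maxr.
- move=> t; rewrite -/L; set n := maxn (shift t) (shift (t + L)).
  rewrite (lineE (leq_maxl _ _ : shift t <= n)%N).
  rewrite (lineE (leq_maxr _ _ : shift (t + L) <= n)%N).
  have -> : t + L + n%:R * L = t + n%:R * L + L by ring.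
  rewrite r_shift; last by apply: shift_ge0; exact: leq_maxl.
  move: (r _) => y.
  by rewrite -{2}(isomVK (g ^+ n)%g y) -isomXS isomXSr isomK.
Qed.

End Axis.

Lemma axis_nonempty g : hyperbolic g -> axis g !=set0.
Proof.
case=> L0 [z zL]; have [c gc] := X_cat.1 z (g z).
exact: axis_nonempty_aux L0 zL _ gc.
Qed.

(** For [w] on the axis, d(x, g x) <= 2 d(x, w) + d(w, g w); nonemptiness of the
    axis matters because the infimum of an empty set of distances is 0. *)
Lemma mdist_le_axis_length x g : hyperbolic g -> mdist x (g x) <= axis_length x g.
Proof.
move=> hg; have [w0 w0ax] := axis_nonempty hg; have L0 := hg.1.
rewrite /axis_length.
suff : (mdist x (g x) - translation_length g) / 2 <= inf [set mdist x w | w in axis g].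
  lra.
apply: lb_le_inf; first by exists (mdist x w0), w0.
move=> _ [w [c [cE cg [t _ tw]]] <-].
have wg : mdist w (g w) = translation_length g.
  by rewrite -tw cg cE ler0_norm; lra.
have := metric_triangle x w (g x); have := metric_triangle w (g w) (g x).
by rewrite isom_dist wg (metric_sym w x); lra.
Qed.

End HyperbolicAxis.

(** * Gromov hyperbolicity and limit rays *)

Section GromovProduct.
Context {R : realType} (X : metricType R).
Implicit Types (p q a b c : X) (g : isom X).

Lemma gromovC p a b : gromov p a b = gromov p b a.
Proof. by rewrite /gromov (metric_sym a b); congr (_ / _); ring. Qed.

Lemma gromov_ge0 p a b : 0 <= gromov p a b.
Proof.
by rewrite /gromov; have := metric_triangle a p b; rewrite (metric_sym a p); lra.
Qed.

Lemma gromov_le_dist p a b : gromov p a b <= mdist p a.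
Proof.
by rewrite /gromov; have := metric_triangle p a b; lra.
Qed.

Lemma gromov_base p q a b : gromov p a b <= gromov q a b + mdist p q.
Proof.
rewrite /gromov; have := metric_triangle p q a; have := metric_triangle p q b.
lra.
Qed.

Lemma gromov_move p a b c : gromov p a b <= gromov p a c + mdist b c.
Proof.
rewrite /gromov; have := metric_triangle p c b; have := metric_triangle a b c.
by rewrite (metric_sym c b); lra.
Qed.

Lemma gromov_isom g p a b : gromov (g p) (g a) (g b) = gromov p a b.
Proof. by rewrite /gromov !isom_dist. Qed.

Lemma gromov_swap p a b : gromov p a b = mdist p a - gromov a p b.
Proof. by rewrite /gromov (metric_sym a p); field. Qed.

Lemma mdist_gromov p a b : mdist a b = mdist p a + mdist p b - 2 * gromov p a b.
Proof. by rewrite /gromov; field. Qed.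

End GromovProduct.

Section Hyperbolicity.
Context {R : realType} (X : metricType R) (X_cat : CAT_minus1 X).
Implicit Types (p q a b : X) (g : isom X) (c : ray X).

(** The three geodesics from [p], cut at the smaller of the two products, are
    consecutively 9-close there. *)
Lemma gromov_hyperbolic p a b d (m : R) :
  m <= gromov p a b -> m <= gromov p b d -> m - 9 <= gromov p a d.
Proof.
move=> mab mbd; have [m0|m0] := leP m 0.
  by have := gromov_ge0 p a d; lra.
have [ca gca] := X_cat.1 p a; have [cb gcb] := X_cat.1 p b.
have [cd gcd] := X_cat.1 p d.
have ab := thin_triangle X_cat gca gcb (ltW m0) mab.
have bd := thin_triangle X_cat gcb gcd (ltW m0) mbd.
have ma : 0 <= m <= mdist p a.
  by rewrite ltW//= (le_trans mab)// gromov_le_dist.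
have md : 0 <= m <= mdist p d.
  by rewrite ltW//= (le_trans mbd)// gromovC gromov_le_dist.
have [a1 a2] := geodesic_dist gca ma; have [d1 d2] := geodesic_dist gcd md.
have := metric_triangle (ca m) (cb m) (cd m).
have := metric_triangle a (ca m) d; have := metric_triangle (ca m) (cd m) d.
by rewrite (metric_sym a (ca m)) /gromov; lra.
Qed.

Lemma geodesic_ray c (t : R) : 0 <= t -> geodesic c (c 0) (c t).
Proof.
move=> t0; have dE : mdist (c 0) (c t) = t.
  by rewrite ray_dist// sub0r normrN ger0_norm.
split; rewrite ?dE// => s u; rewrite ?dE => /andP[s0 _] /andP[u0 _].
exact: ray_dist.
Qed.

Lemma mdist_ray0 c (t : R) : 0 <= t -> mdist (c 0) (c t) = t.
Proof. by move=> t0; rewrite ray_dist// sub0r normrN ger0_norm. Qed.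

(** Both rays stay 9-close to the geodesic from [c 0] to a far point of [c'], the
    second one up to a shift of the parameter by at most d(c 0, c' 0), and only
    after that time. *)
Lemma ray_dist_bound c c' (u : R) : 0 <= u ->
  (exists t t', [/\ 0 <= t, 0 <= t' & u <= gromov (c 0) (c t) (c' t')]) ->
  mdist (c u) (c' u) <= 3 * mdist (c 0) (c' 0) + 18.
Proof.
move=> u0 [t [t' [t0 t'0 ug]]].
set p := c 0 in ug *; set q := c' 0; set D := mdist p q.
have D0 : 0 <= D by exact: mdist_ge0.
have [uD|Du] := ltP u D.
  have := metric_triangle (c u) p (c' u); have := metric_triangle p q (c' u).
  by rewrite (metric_sym (c u) p) !mdist_ray0// -/D; lra.
have [e ge] := X_cat.1 p (c' t').
have ce := thin_triangle X_cat (geodesic_ray c t0) ge u0 ug.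
set L := mdist p (c' t') in ge.
have uL : u <= L by rewrite (le_trans ug)// gromovC gromov_le_dist.
have LtD : `|L - t'| <= D.
  have := mdist_ler_dist (c' t') p q.
  by rewrite !(metric_sym (c' t')) mdist_ray0.
have [lb ub] : t' - D <= L /\ L <= t' + D by move: LtD; rewrite ler_norml; lra.
have vg : L - u <= gromov (c' t') p q.
  by rewrite /gromov !(metric_sym (c' t')) mdist_ray0// -/L -/D; lra.
have gr := geodesic_rev ge; have gr' := geodesic_rev (geodesic_ray c' t'0).
have v0 : 0 <= L - u by lra.
have ee := thin_triangle X_cat gr gr' v0 vg; rewrite -/L mdist_ray0// in ee.
rewrite (_ : L - (L - u) = u) in ee; last by ring.
have v't : L - u <= t'.
  by apply: (le_trans vg); rewrite gromovC (le_trans (gromov_le_dist _ _ _))//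
    (metric_sym (c' t')) mdist_ray0.
have := metric_triangle (c u) (e u) (c' u).
have := metric_triangle (e u) (c' (t' - (L - u))) (c' u).
rewrite (ray_dist c')//; last lra.
have -> : t' - (L - u) - u = t' - L by ring.
by rewrite distrC; lra.
Qed.

Lemma asymptotic_of_gromov x c c' :
  (forall M : R, exists t t', [/\ 0 <= t, 0 <= t' & M <= gromov x (c t) (c' t')]) ->
  asymptotic c c'.
Proof.
move=> H; apply/asboolP; exists (3 * mdist (c 0) (c' 0) + 18) => u u0.
apply: ray_dist_bound => //.
have [t [t' [t0 t'0 Hg]]] := H (u + mdist x (c 0)).
exists t, t'; split=> //.
by have := gromov_base x (c 0) (c t) (c' t'); lra.
Qed.

Lemma not_asymptotic_gromov x c c' : ~~ asymptotic c c' ->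
  exists K : R, forall t t', 0 <= t -> 0 <= t' -> gromov x (c t) (c' t') <= K.
Proof.
move=> nas; apply: contrapT => H; move/negP: nas; apply.
apply: (asymptotic_of_gromov (x := x)) => M; apply: contrapT => HM; apply: H.
exists M => t t' t0 t'0; rewrite leNgt; apply/negP => Mt.
by apply: HM; exists t, t'; split=> //; exact: ltW.
Qed.

Lemma asymptotic_gromov x c c' (M t t' : R) :
  (forall t, 0 <= t -> mdist (c t) (c' t) <= M) -> 0 <= t -> 0 <= t' ->
  Num.min t t' - (mdist x (c 0) + mdist x (c' 0) + M) / 2 <= gromov x (c t) (c' t').
Proof.
move=> HM t0 t'0; rewrite /gromov.
have := metric_triangle (c 0) x (c t); have := metric_triangle (c' 0) x (c' t').
rewrite !mdist_ray0// !(metric_sym _ x).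
have := metric_triangle (c t) (c t') (c' t'); have := HM _ t'0.
rewrite ray_dist//; case: (leP t t') => tt'.
  by rewrite ler0_norm; lra.
by rewrite gtr0_norm; lra.
Qed.

Lemma ray_isom_dist g c (s t : R) : 0 <= s -> 0 <= t ->
  mdist ((g \o c) s) ((g \o c) t) = `|s - t|.
Proof. by move=> s0 t0; rewrite /= isom_dist ray_dist. Qed.

Definition ray_isom g c : ray X := Ray (ray_isom_dist g c).

End Hyperbolicity.

Section LimitRay.
Context {R : realType} (X : metricType R).
Hypotheses (X_proper : proper_space X) (X_cat : CAT_minus1 X).

(** Closed balls being compact, the points at distance [t] on the geodesics
    from [x] to [y i] converge along [U]. *)
Lemma limit_ray (I : Type) (U : set_system I) (FU : UltraFilter U)
    (y : I -> X) (x : X) :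
  (forall r : R, U [set i | r <= mdist x (y i)]) ->
  exists2 c : ray X, c 0 = x &
    forall t, 0 <= t -> U [set i | t - 1 <= gromov x (y i) (c t)].
Proof.
move=> yoo.
have [e ge] := choice (fun i => X_cat.1 x (y i)).
have lim_pt (t : R) : exists p : X, 0 <= t ->
    forall eps : R, 0 < eps -> U [set i | mdist p (e i t) < eps].
  have [t0|t0] := leP 0 t; last by exists x => t0'; lra.
  pose B := [set z | mdist x z <= t].
  pose F := [set A | U [set i | A (e i t)]].
  have FF : ProperFilter F.
    split; first by rewrite /F/= => /filter_ex[].
    split; rewrite /F/=.
    - exact: filterT.
    - by move=> P Q FP FQ; apply: filterI.
    - by move=> P Q PQ; apply: filterS => i; exact: PQ.
  have FB : F B.
    rewrite /F/=; apply: filterS (yoo t) => i /= tyi.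
    by rewrite /B/= (geodesic_dist (ge i) _).1// t0.
  have [p [_ clp]] := X_proper FF FB.
  exists p => _ eps eps0.
  have [//|nU] := in_ultra_setVsetC [set i | mdist p (e i t) < eps] FU.
  have [z [/= nz pz]] := clp [set z | ~ mdist p z < eps] (ball p eps) nU (nbhsx_ballx _ _ eps0).
  by move: pz; rewrite ballEmdist.
have [c0 Hc0] := choice lim_pt.
have e0 i : e i 0 = x by case: (ge i).
have cE (s t : R) : 0 <= s -> 0 <= t -> mdist (c0 s) (c0 t) = `|s - t|.
  move=> s0 t0; apply/eqP; rewrite -subr_eq0 -normr_eq0 eq_le normr_ge0 andbT.
  apply/ler_addgt0Pr => eps eps0; rewrite add0r.
  have e2 : 0 < eps / 2 by lra.
  have W : U ([set i | mdist (c0 s) (e i s) < eps / 2] `&`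
      [set i | mdist (c0 t) (e i t) < eps / 2] `&`
      [set i | s <= mdist x (y i)] `&` [set i | t <= mdist x (y i)]).
    by apply: filterI => //; apply: filterI => //; apply: filterI; exact: Hc0.
  have [i /= [[[pis pit] si] ti]] := filter_ex W.
  have est : mdist (e i s) (e i t) = `|s - t|.
    by have [_ _ ->] := ge i; rewrite ?s0 ?t0.
  have := metric_triangle (c0 s) (e i s) (c0 t).
  have := metric_triangle (e i s) (e i t) (c0 t).
  have := metric_triangle (e i s) (c0 s) (e i t).
  have := metric_triangle (c0 s) (c0 t) (e i t).
  rewrite (metric_sym (e i s) (c0 s)) (metric_sym (e i t) (c0 t)) est.
  by move=> ? ? ? ?; rewrite ler_norml; lra.
exists (Ray cE) => /=.
  have [d0|//] : mdist x (c0 0) = 0 \/ False.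
    left; apply/eqP; rewrite eq_le mdist_ge0 andbT.
    apply/ler_addgt0Pr => eps eps0; rewrite add0r.
    have /filter_ex[i /=] := Hc0 0 (lexx _) _ eps0.
    by rewrite e0 metric_sym => /ltW.
  exact/esym/mdist_positivity.
move=> t t0; apply: filterS2 (yoo t) (Hc0 t t0 _ ltr01) => i /= ty pe.
have [e1 e2] := geodesic_dist (ge i) (introT andP (conj t0 ty)).
have := metric_triangle (y i) (e i t) (c0 t).
have := metric_triangle x (c0 t) (e i t).
rewrite /gromov (metric_sym (y i) (e i t)) (metric_sym (e i t) (c0 t)).
lra.
Qed.

End LimitRay.

(** * The Poincare series *)

Section BoundedSums.
Context {R : realType} {T : choiceType}.
Implicit Types (A B : set T) (f : T -> R) (l : seq T).

(** Summability of a nonnegative family, phrased with duplicate-free lists. *)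
Definition bounded_sums A f : Prop :=
  exists M : R, forall l, uniq l -> (forall g, g \in l -> A g) ->
    \sum_(g <- l) f g <= M.

Lemma sum_le_esum A f l : (forall g, 0 <= f g) -> uniq l ->
  (forall g, g \in l -> A g) ->
  ((\sum_(g <- l) f g)%:E <= \esum_(g in A) (f g)%:E)%E.
Proof.
move=> f0 ul lA; apply: esum_ge; exists [set` l].
  by split; [exact: finite_seq|move=> g /=; exact: lA].
by rewrite -fsbig_seq// sumEFin.
Qed.

Lemma bounded_sums_esum A f : (forall g, 0 <= f g) ->
  bounded_sums A f <-> (\esum_(g in A) (f g)%:E < +oo)%E.
Proof.
move=> f0; split=> [[M HM]|fin].
  apply: (@le_lt_trans _ _ M%:E); last exact: ltry.
  apply: ge_ereal_sup => _ [F [Ff FA] <-].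
  rewrite fsbig_finite// sumEFin lee_fin; apply: HM; first exact: finmap.fset_uniq.
  by move=> g; rewrite in_fset_set// inE => /FA.
exists (fine (\esum_(g in A) (f g)%:E)) => l ul lA.
rewrite -lee_fin fineK; first exact: sum_le_esum.
by rewrite ge0_fin_numE//; apply: esum_ge0 => g _; rewrite lee_fin.
Qed.

Lemma bounded_sums_sub A B f : B `<=` A -> bounded_sums A f -> bounded_sums B f.
Proof. by move=> BA [M HM]; exists M => l ul lB; apply: HM => // g /lB /BA. Qed.

Lemma bounded_sumsU A B f : bounded_sums A f -> bounded_sums B f ->
  bounded_sums (A `|` B) f.
Proof.
move=> [M HM] [N HN]; exists (M + N) => l ul lAB.
rewrite (bigID (fun g => `[< A g >]))/= lerD//; rewrite -big_filter.
  by apply: HM; rewrite ?filter_uniq// => g; rewrite mem_filter => /andP[/asboolP].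
apply: HN; rewrite ?filter_uniq// => g; rewrite mem_filter => /andP[/asboolPn nA].
by move=> /lAB[].
Qed.

Lemma sum_sub_le f l l' : (forall g, 0 <= f g) -> uniq l -> {subset l <= l'} ->
  \sum_(g <- l) f g <= \sum_(g <- l') f g.
Proof.
move=> f0 ul sub; elim: l' l ul sub => [|a l' IH] l ul sub.
  by case: l sub {ul} => [|b l] sub; [|have := sub b (mem_head _ _)].
have [al|al] := boolP (a \in l).
  rewrite (perm_big _ (perm_to_rem al)) !big_cons lerD2l; apply: IH.
    exact: rem_uniq.
  by move=> b; rewrite mem_rem_uniq// inE => /andP[/= ba /sub]; rewrite inE (negPf ba).
rewrite big_cons ler_wpDl//; apply: IH => // b bl.
by have := sub b bl; rewrite inE => /orP[/eqP ba|//]; rewrite -ba bl in al.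
Qed.

Lemma sum_ge_size f l (a : R) : (forall g, g \in l -> a <= f g) ->
  (size l)%:R * a <= \sum_(g <- l) f g.
Proof.
elim: l => [|b l IH] H; first by rewrite big_nil mul0r.
rewrite big_cons /= -natr1 mulrDl mul1r addrC lerD ?H ?mem_head//.
by apply: IH => g gl; apply: H; rewrite inE gl orbT.
Qed.

Lemma sum_le_size f l (a : R) : (forall g, g \in l -> f g <= a) ->
  \sum_(g <- l) f g <= (size l)%:R * a.
Proof.
elim: l => [|b l IH] H; first by rewrite big_nil mul0r.
rewrite big_cons /= -natr1 mulrDl mul1r addrC lerD ?H ?mem_head//.
by apply: IH => g gl; apply: H; rewrite inE gl orbT.
Qed.

End BoundedSums.

Section PoincareSeries.
Context {R : realType} {X : metricType R}.
Implicit Types (Gam : set (isom X)) (g : isom X) (s : R) (l : seq (isom X)).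
Variable x : X.

Definition weight s g : R := expR (- (s * mdist x (g x))).

Lemma weight_ge0 s g : 0 <= weight s g. Proof. exact: expR_ge0. Qed.

Lemma weight_gt0 s g : 0 < weight s g. Proof. exact: expR_gt0. Qed.

Lemma weight_le s s' g : s <= s' -> weight s' g <= weight s g.
Proof. by move=> ss'; rewrite ler_expR lerN2 ler_wpM2r// mdist_ge0. Qed.

Lemma weightM s g h : 0 <= s -> weight s g * weight s h <= weight s (g * h)%g.
Proof.
move=> s0; rewrite /weight -expRD ler_expR isomM.
have := metric_triangle x (g x) (g (h x)); rewrite isom_dist => tri.
by rewrite -opprD lerN2 -mulrDr ler_wpM2l.
Qed.

Lemma critical_exponent_lt Gam s : (critical_exponent Gam x < s%:E)%E ->
  bounded_sums Gam (weight s).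
Proof.
move=> /ereal_inf_lt[_ [s0 [_ fin] <-]]; rewrite lte_fin => s0s.
have [M HM] : bounded_sums Gam (weight s0).
  by apply/bounded_sums_esum => // g; exact: weight_ge0.
exists M => l ul lG; apply: le_trans (HM l ul lG).
by apply: ler_sum => g _; apply: weight_le; exact: ltW.
Qed.

Lemma critical_exponent_le Gam s : 0 < s -> bounded_sums Gam (weight s) ->
  (critical_exponent Gam x <= s%:E)%E.
Proof.
move=> s0 bs; apply: ereal_inf_lbound; exists s => //; split=> //.
by apply/bounded_sums_esum => // g; exact: weight_ge0.
Qed.

(** Each such [g] contributes at least exp(- s r) to a convergent Poincare
    series. *)
Lemma orbit_locally_finite Gam (r : R) : (critical_exponent Gam x < +oo)%E ->
  exists N : nat, forall l, uniq l -> (forall g, g \in l -> Gam g) ->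
    (forall g, g \in l -> mdist x (g x) <= r) -> (size l <= N)%N.
Proof.
move=> /ereal_inf_lt[_ [s [s0 fin] <-] _].
have [M HM] : bounded_sums Gam (weight s).
  by apply/bounded_sums_esum => // g; exact: weight_ge0.
have e0 := expR_gt0 (- (s * r)).
exists (Num.truncn (M / expR (- (s * r)))) => l ul lG lr.
rewrite leqNgt; apply/negP => big; have := HM l ul lG; apply/negP; rewrite -ltNge.
have : M < (size l)%:R * expR (- (s * r)).
  rewrite -ltr_pdivrMr//; apply: lt_le_trans (truncnS_gt _) _.
  by rewrite ler_nat.
move=> /lt_le_trans; apply; apply: sum_ge_size => g /lr gr.
by rewrite ler_expR lerN2 ler_wpM2l// ltW.
Qed.

End PoincareSeries.

(** * Reduced words in the Bass-Serre tree *)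

Section Trees.
Variables (V E : Type) (Y : sgraph V E).
Implicit Types (u v w : V) (e f : E) (p q : seq E).

Fixpoint backtrack p q : seq E :=
  if p is e :: p' then backtrack p' (Defs.rev Y e :: q) else q.

Lemma backtrack_path p q u v w :
  edge_path Y u p v -> edge_path Y u q w -> edge_path Y v (backtrack p q) w.
Proof.
elim: p u q => [|e p IH] u q /= => [<-//|[eu pv] qw].
by apply: IH pv _ => /=; split=> //; rewrite /ter Defs.revK eu.
Qed.

Lemma backtrack_nil p q : backtrack p q = [::] -> p = [::].
Proof.
have sz : size (backtrack p q) = (size p + size q)%N.
  by elim: p q => // e p IH q /=; rewrite IH /= addnS.
by move=> pq; move: sz; rewrite pq; case: p {pq}.
Qed.

Lemma backtrack_reduced p q : reduced Y p -> reduced Y q ->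
  (if p is e :: _ then if q is f :: _ then e <> f else True else True) ->
  reduced Y (backtrack p q).
Proof.
elim: p q => [|e p IH] q //= [ep rp] rq epq; apply: IH => //=.
  by split=> //; case: q epq {rq} => // f q ef; rewrite Defs.revK; apply: nesym.
Qed.

(** After a common beginning, [p] run backwards followed by [q] is a closed
    reduced path. *)
Lemma reduced_path_unique (Ytree : is_tree Y) u v p q :
  edge_path Y u p v -> edge_path Y u q v -> reduced Y p -> reduced Y q -> p = q.
Proof.
case: Ytree => _ _ closed.
elim: p u q => [|e p IH] u q.
  by move=> /= -> qv _ rq; rewrite (closed _ _ qv rq).
case: q => [|f q]; first by move=> pv /= uv; rewrite -uv in pv; move=> rp _; exact: closed pv rp.
move=> pv qv rp rq; have [ef|ef] := pselect (e = f).
  rewrite -ef in qv rq *; congr (_ :: _).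
  by case: pv qv rp rq => /= _ pv [_ qv] [_ rp] [_ rq]; exact: IH pv qv rp rq.
have := closed _ _ (backtrack_path pv qv) (backtrack_reduced rp rq ef).
by move/backtrack_nil.
Qed.

End Trees.

Section ReducedWords.
Context {G : groupType} {H : set G} (D : decomposition H) (F : lifting D).
Hypothesis Hgroup : subgroup H.
Implicit Types (e f : quoE D) (g h w : G) (c : set G) (P : seq (treeE D)).

Let H1 : H 1%g := Hgroup.1.

Lemma subgroupV g : H g -> H g^-1%g.
Proof. by move=> Hg; rewrite -(mul1g g^-1%g); exact: Hgroup.2. Qed.

Lemma subgroupM g h : H g -> H h -> H (g * h)%g.
Proof. by move=> Hg Hh; rewrite -(invgK h); apply: Hgroup.2 => //; exact: subgroupV. Qed.

Lemma actEK g (E : treeE D) : H g -> actE g^-1%g (actE g E) = E.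
Proof. by move=> Hg; rewrite -actEM ?mulVg ?actE1//; exact: subgroupV. Qed.

Lemma actE_inj g : H g -> injective (@actE _ _ D g).
Proof. by move=> Hg E E' EE'; rewrite -(actEK E Hg) EE' actEK. Qed.

Lemma act_ter g (E : treeE D) : H g -> ter (tree D) (actE g E) = actV g (ter (tree D) E).
Proof. by move=> Hg; rewrite /ter act_rev// act_org. Qed.

Lemma act_edge_path g u P v : H g -> edge_path (tree D) u P v ->
  edge_path (tree D) (actV g u) [seq actE g E | E <- P] (actV g v).
Proof.
move=> Hg; elim: P u => [|E P IH] u /=; first by move=> ->.
by move=> [Eu Pv]; split; [rewrite act_org// Eu|rewrite act_ter//; exact: IH].
Qed.

Lemma act_reduced g P : H g -> reduced (tree D) P ->
  reduced (tree D) [seq actE g E | E <- P].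
Proof.
move=> Hg; elim: P => [|E P IH] //= [EP rP]; split; last exact: IH.
case: P EP {IH rP} => [|E' P] //= EP; rewrite act_rev// => /(actE_inj Hg).
exact: EP.
Qed.

Lemma projE_act g (E : treeE D) : H g -> projE (actE g E) = projE E.
Proof. by move=> Hg; apply/esym/projE_orbit; exists g. Qed.

Lemma edge_cosetsP f c g : edge_cosets F f c -> c g ->
  [/\ H g, actV g (liftV F (org (quo D) f)) = liftV F (org (quo D) f) &
      c = left_coset F g f].
Proof.
move=> [r [Hr rv] <-] [h [Hh hE] <-].
have hv : actV h (liftV F (org (quo D) f)) = liftV F (org (quo D) f).
  by rewrite -lift_org -act_org// hE.
split; [exact: subgroupM|by rewrite actVM// hv|].
apply/seteqP; split=> _ [k [Hk kE] <-].
  exists (h^-1 * k)%g; last by rewrite -mulgA mulVKg.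
  split; first by apply: subgroupM => //; exact: subgroupV.
  by rewrite actEM//; [rewrite kE -{1}hE actEK|exact: subgroupV].
exists (h * k)%g; last by rewrite mulgA.
by split; [exact: subgroupM|rewrite actEM// kE hE].
Qed.

(** Projecting to the quotient graph recovers [f]; then [g'^-1 g] fixes the
    lifted edge. *)
Lemma lifted_edge_inj f f' c c' g g' :
  edge_cosets F f c -> c g -> edge_cosets F f' c' -> c' g' ->
  actE g (liftE F f) = actE g' (liftE F f') -> f = f' /\ c = c'.
Proof.
move=> fc cg fc' cg' gg'.
have [Hg gv cE] := edge_cosetsP fc cg; have [Hg' gv' cE'] := edge_cosetsP fc' cg'.
have ff' : f = f' by rewrite -(liftEK F f) -(liftEK F f') -(projE_act _ Hg) gg' projE_act.
subst f'; split=> //; rewrite cE cE'.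
have k1 : edge_group F f (g'^-1 * g)%g.
  split; first by apply: subgroupM => //; exact: subgroupV.
  by rewrite actEM//; [rewrite gg' actEK|exact: subgroupV].
have cg'g : left_coset F g' f g by exists (g'^-1 * g)%g => //; rewrite mulVKg.
have fc'' : edge_cosets F f (left_coset F g' f) by rewrite -cE'.
by have [_ _ ->] := edge_cosetsP fc'' cg'g.
Qed.

(** The last clause remembers the label of the first edge: it is what excludes
    backtracking when a further step is prepended. *)
Definition traces e w f k P : Prop :=
  [/\ H w, edge_path (tree D) (liftV F (ter (quo D) e)) P
             (actV w (liftV F (ter (quo D) f))),
      reduced (tree D) P, size P = k &
      forall E P', P = E :: P' -> exists f1 c g,
        [/\ allowed F e f1 c, c g & E = actE g (liftE F f1)]].

Lemma traces_nil e : traces e 1%g e 0 [::].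
Proof. by split=> //=; rewrite actV1. Qed.

(** The new path is reduced because of the condition c <> G_f for f = bar e: if
    the translated second edge were the reverse of the first, its label would be
    the trivial coset. *)
Lemma traces_cons e f1 f c g w k P : allowed F e f1 c -> c g ->
  traces f1 w f k P ->
  traces e (g * tau F f1 * w)%g f k.+1
    (actE g (liftE F f1) :: [seq actE (g * tau F f1)%g E | E <- P]).
Proof.
move=> al cg [Hw Pp Pr <- Ph]; have [ef fc _] := al.
have [Hg gv cE] := edge_cosetsP fc cg.
have Ht := tau_in F f1; have Hgt := subgroupM Hg Ht.
have terE : ter (tree D) (actE g (liftE F f1)) =
            actV (g * tau F f1)%g (liftV F (ter (quo D) f1)).
  by rewrite act_ter// lift_ter -actVM.
split.
- exact: subgroupM.
- split=> /=; first by rewrite act_org// lift_org gv ef.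
  by rewrite terE (actVM _ Hgt Hw); exact: act_edge_path.
- split=> /=; last exact: act_reduced.
  case: P Ph {Pp Pr} => [|E P] //= /(_ _ _ erefl)[f2 [c2 [g2 [al2 cg2 ->]]]].
  have [ef2 fc2 ne2] := al2; have [Hg2 gv2 cE2] := edge_cosetsP fc2 cg2.
  move=> EE; have : projE (actE (g * tau F f1)%g (actE g2 (liftE F f2))) =
                    projE (Defs.rev (tree D) (actE g (liftE F f1))) by rewrite EE.
  rewrite -proj_rev !projE_act// !liftEK => f2E; have := ne2 f2E; apply.
  have e2 : edge_group F f2 g2.
    split=> //; apply: (actE_inj Hgt); rewrite EE act_rev// actEM// f2E lift_rev.
    by rewrite -(actEM _ Ht (subgroupV Ht)) mulgV actE1.
  have : left_coset F 1%g f2 g2 by exists g2 => //; rewrite mul1g.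
  rewrite cE2 => cg1.
  have f1c : edge_cosets F f2 (left_coset F 1%g f2).
    by exists 1%g => //; split=> //; rewrite actV1.
  have [_ _ <-] := edge_cosetsP f1c cg1.
  by apply/seteqP; split=> [_ [h Hh <-]|h Hh]; [rewrite mul1g|exists h; rewrite ?mul1g].
- by rewrite /= size_map.
- by move=> _ _ [<- _]; exists f1, c, g.
Qed.

Lemma traces_unique e w f k k' P P' :
  traces e w f k P -> traces e w f k' P' -> P = P'.
Proof.
move=> [_ Pp Pr _ _] [_ Pp' Pr' _ _].
exact: reduced_path_unique (tree_is_tree D) _ _ _ _ Pp Pp' Pr Pr'.
Qed.

End ReducedWords.

Lemma uniq_flatten_map (S T : eqType) (s : seq S) (t : S -> seq T) :
  uniq s -> (forall a, a \in s -> uniq (t a)) ->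
  (forall a b y, a \in s -> b \in s -> y \in t a -> y \in t b -> a = b) ->
  uniq (flatten [seq t a | a <- s]).
Proof.
elim: s => //= a s IH /andP[as' us] ut disj; rewrite cat_uniq ut ?mem_head//=.
have -> : uniq (flatten [seq t a | a <- s]).
  apply: IH => // [b bs|b c y bs cs]; first by apply: ut; rewrite inE bs orbT.
  by apply: disj; rewrite inE ?bs ?cs orbT.
rewrite andbT; apply/hasPn => y /flattenP[_ /mapP[b bs ->] yb]; apply/negP => ya.
have ab := disj a b y (mem_head _ _) _ ya yb.
by rewrite ab ?inE ?bs ?orbT// bs in as'.
Qed.

Section WordLists.
Context {G : groupType} {H : set G} (D : decomposition H) (F : lifting D).
Hypothesis Hgroup : subgroup H.
Variables (n : nat) (ev : 'I_n -> quoE D) (ev_inj : injective ev).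
Variables (lab : 'I_n -> 'I_n -> seq (set G)) (elt : 'I_n -> 'I_n -> set G -> G).
Hypothesis lab_uniq : forall i j, uniq (lab i j).
Hypothesis labP : forall i j c, c \in lab i j -> allowed F (ev i) (ev j) c /\
  exists2 g, c g & elt i j c = (g * tau F (ev j))%g.

Definition labels i : seq ('I_n * set G) :=
  [seq (l, c) | l <- enum 'I_n, c <- lab i l].

Lemma labelsP i l c : ((l, c) \in labels i) = (c \in lab i l).
Proof.
apply/allpairsPdep/idP => [[l' [c' [_ cl [-> ->]]]]//|cl].
by exists l, c; split=> //; rewrite mem_enum.
Qed.

Lemma labels_uniq i : uniq (labels i).
Proof.
apply: allpairs_uniq_dep => //; first exact: enum_uniq.
by move=> [l c] [l' c'] _ _ /= [-> ->].
Qed.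

Fixpoint words k i j : seq G :=
  if k is k'.+1 then
    flatten [seq [seq (elt i a.1 a.2 * w)%g | w <- words k' a.1 j] | a <- labels i]
  else if i == j then [:: 1%g] else [::].

Lemma words_consP k i j w : w \in words k.+1 i j ->
  exists l c w', [/\ c \in lab i l, w' \in words k l j & w = (elt i l c * w')%g].
Proof.
move=> /flattenP[_ /mapP[[l c] lc ->] /mapP[w' ww' ->]].
by exists l, c, w'; split=> //; rewrite -labelsP.
Qed.

Lemma words_trace k i j w : w \in words k i j ->
  exists P, traces F (ev i) w (ev j) k P.
Proof.
elim: k i w => [|k IH] i w.
  rewrite /=; case: eqP => // ->; rewrite inE => /eqP ->.
  by exists [::]; exact: traces_nil.
move=> /words_consP[l [c [w' [cl ww' ->]]]].
have [P HP] := IH _ _ ww'; have [al [g cg ->]] := labP cl.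
by eexists; exact (traces_cons Hgroup al cg HP).
Qed.

Lemma words_sub k i j w : w \in words k i j -> H w.
Proof. by move=> /words_trace[P []]. Qed.

(** Distinct labelled paths trace distinct reduced paths in the tree. *)
Lemma words_uniq k i j : uniq (words k i j).
Proof.
elim: k i => [|k IH] i; first by rewrite /=; case: eqP.
apply: uniq_flatten_map; first exact: labels_uniq.
  by move=> [l c] _; rewrite map_inj_uniq//; exact: mulgI.
move=> [l c] [l' c'] y; rewrite !labelsP => cl cl' /mapP[w ww ->] /mapP[w' ww'].
have [P HP] := words_trace ww; have [P' HP'] := words_trace ww'.
have [al [g cg ->]] := labP cl; have [al' [g' cg' ->]] := labP cl' => E.
have T := traces_cons Hgroup al cg HP; have T' := traces_cons Hgroup al' cg' HP'.
rewrite E in T; have [EE _] := traces_unique T T'.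
have [_ fc _] := al; have [_ fc' _] := al'.
by have [/ev_inj -> ->] := lifted_edge_inj Hgroup fc cg fc' cg' EE.
Qed.

Lemma words_length k k' i j w : w \in words k i j -> w \in words k' i j -> k = k'.
Proof.
move=> /words_trace[P TP] /words_trace[P' TP']; have := traces_unique TP TP'.
by case: TP => _ _ _ <- _; case: TP' => _ _ _ <- _ ->.
Qed.

Context {R : realType}.
Variables (W : G -> R) (B : 'M[R]_n).
Hypotheses (W0 : forall g, 0 <= W g) (W1 : 1 <= W 1%g)
  (WM : forall g h, W g * W h <= W (g * h)%g).
Hypothesis B0 : forall i j, 0 <= B i j.
Hypothesis BW : forall i j, B i j <= \sum_(c <- lab i j) W (elt i j c).

Lemma power_ge0 k i j : 0 <= (B ^+ k) i j.
Proof.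
elim: k i => [|k IH] i; first by rewrite expr0 mxE; case: eqP.
by rewrite exprS -mulmxE mxE sumr_ge0// => l _; rewrite mulr_ge0.
Qed.

(** Expanding the matrix power gives one term for each labelled path, and [W] is
    supermultiplicative. *)
Lemma power_le_words k i j : (B ^+ k) i j <= \sum_(w <- words k i j) W w.
Proof.
elim: k i => [|k IH] i.
  rewrite expr0 mxE /=; case: eqP => _; last by rewrite big_nil.
  by rewrite big_seq1.
rewrite exprS -mulmxE mxE /= big_flatten big_map big_allpairs_dep /= big_enum /=.
apply: ler_sum => l _.
apply: (@le_trans _ _ (\sum_(c <- lab i l) W (elt i l c) * (B ^+ k) l j)).
  by rewrite -big_distrl/= ler_wpM2r// power_ge0.
apply: ler_sum => c _; rewrite big_map.
apply: (@le_trans _ _ (W (elt i l c) * \sum_(w <- words k l j) W w)).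
  by rewrite ler_wpM2l.
by rewrite big_distrr/=; apply: ler_sum => w _; exact: WM.
Qed.

(** The words of all lengths are distinct elements of the group, so their total
    weight is a partial sum of the series over [A]. *)
Lemma power_series_le (A : set G) (M : R) : H `<=` A ->
  (forall l, uniq l -> (forall g, g \in l -> A g) -> \sum_(g <- l) W g <= M) ->
  forall K i j, \sum_(k < K) (B ^+ k) i j <= M.
Proof.
move=> HA HM K i j.
apply: (@le_trans _ _ (\sum_(k <- iota 0 K) \sum_(w <- words k i j) W w)).
  rewrite -[X in iota _ X]subn0 -/(index_iota 0 K) big_mkord.
  by apply: ler_sum => k _; exact: power_le_words.
rewrite -(big_map (fun k => words k i j) xpredT (fun s => \sum_(w <- s) W w)).
rewrite -big_flatten; apply: HM.
- apply: uniq_flatten_map => [|k _|k k' w _ _]; [exact: iota_uniq|exact: words_uniq|].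
  exact: words_length.
- by move=> w /flattenP[_ /mapP[k _ ->] /words_sub /HA].
Qed.

End WordLists.

(** * Powers and spectral radii of nonnegative matrices *)

Lemma archimedean_mul {R : realType} (M a : R) : 0 < a -> exists m : nat, M < m%:R * a.
Proof.
by move=> a0; exists (Num.truncn (M / a)).+1; rewrite -ltr_pdivrMr// truncnS_gt.
Qed.

Section NonnegativeMatrices.
Context {R : realType}.
Variables (n : nat) (B : 'M[R]_n).
Hypothesis B0 : forall i j, 0 <= B i j.
Implicit Types (i j l : 'I_n) (k m : nat).

Let pow_ge0 k i j : 0 <= (B ^+ k) i j := power_ge0 B0 k i j.

Lemma powerD_ge a b i j l : (B ^+ a) i j * (B ^+ b) j l <= (B ^+ (a + b)) i l.
Proof.
rewrite exprD -mulmxE mxE (bigD1 j)//= lerDl sumr_ge0// => l' _.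
by rewrite mulr_ge0.
Qed.

Lemma powerXn_ge k i m : (B ^+ k) i i ^+ m <= (B ^+ (k * m)) i i.
Proof.
elim: m => [|m IH]; first by rewrite muln0 !expr0 mxE eqxx.
rewrite exprS mulnS; apply: le_trans (powerD_ge k (k * m) i i i).
by rewrite ler_wpM2l.
Qed.

(** A diagonal entry of a power exceeding 1 would have unbounded powers. *)
Lemma loop_le1 (M : R) k i : (forall K, \sum_(k < K) (B ^+ k) i i <= M) ->
  (0 < k)%N -> (B ^+ k) i i <= 1.
Proof.
move=> HM k0; rewrite leNgt; apply/negP => a1; set a := (B ^+ k) i i in a1.
have aM m : a ^+ m <= M.
  apply: le_trans (powerXn_ge k i m) _; apply: le_trans (HM (k * m).+1).
  by rewrite big_ord_recr/= lerDr sumr_ge0.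
have bern m : m%:R * (a - 1) <= a ^+ m.
  elim: m => [|m IH]; first by rewrite mul0r expr0.
  have am : 1 <= a ^+ m by rewrite exprn_ege1// ltW.
  rewrite exprS -natr1; nra.
have a10 : 0 < a - 1 by rewrite subr_gt0.
have [m Mm] := archimedean_mul M a10.
by have := le_trans (bern m) (aM m); rewrite leNgt Mm.
Qed.

Lemma power_le_mono (A : 'M[R]_n) : (forall i j, 0 <= A i j <= B i j) ->
  forall k i j, (A ^+ k) i j <= (B ^+ k) i j.
Proof.
move=> AB; elim=> [|k IH] i j; first by rewrite !expr0.
rewrite !exprS -!mulmxE !mxE ler_sum// => l _.
have /andP[A0 Al] := AB i l; apply: ler_pM => //.
by apply: power_ge0 => i' j'; have /andP[] := AB i' j'.
Qed.

Lemma powerZ (a : R) k i j : ((a *: B) ^+ k) i j = a ^+ k * (B ^+ k) i j.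
Proof.
suff -> : (a *: B) ^+ k = a ^+ k *: B ^+ k by rewrite mxE.
elim: k => [|k IH]; first by rewrite !expr0 scale1r.
by rewrite !exprS IH -!mulmxE -scalemxAl -scalemxAr scalerA.
Qed.

End NonnegativeMatrices.

Section SpectralRadiusBounds.
Context {R : realType}.
Variables (n : nat) (B : 'M[R]_n).
Hypothesis B0 : forall i j, 0 <= B i j.
Local Notation normc := (@ComplexField.Normc.normc R).
Local Notation BC := (map_mx (real_complex R) B).

Lemma normc_real (r : R) : 0 <= r -> normc (real_complex R r) = r.
Proof.
by move=> r0; rewrite /ComplexField.Normc.normc /= expr0n/= addr0 sqrtr_sqr ger0_norm.
Qed.

Lemma normc_ge0 (z : R[i]) : 0 <= normc z.
Proof. by case: z => a b; rewrite sqrtr_ge0. Qed.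

Lemma normcX (z : R[i]) k : normc (z ^+ k) = normc z ^+ k.
Proof.
elim: k => [|k IH]; first by rewrite !expr0 ComplexField.Normc.normc1.
by rewrite !exprS ComplexField.Normc.normcM IH.
Qed.

Lemma normc_sum (I : Type) (s : seq I) (f : I -> R[i]) :
  normc (\sum_(i <- s) f i) <= \sum_(i <- s) normc (f i).
Proof.
elim: s => [|a s IH]; first by rewrite !big_nil ComplexField.Normc.normc0.
by rewrite !big_cons; apply: le_trans (le_normcD _ _) _; rewrite lerD2l.
Qed.

(** Take absolute values in v B^k = z^k v; here [a] consists of the absolute
    values of the entries of a left eigenvector. *)
Lemma eigenvalue_power (z : R[i]) : eigenvalue BC z ->
  exists (a : 'I_n -> R) j, [/\ forall i, 0 <= a i, 0 < a j &
    forall k, normc z ^+ k * a j <= \sum_i a i * (B ^+ k) i j].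
Proof.
move=> /eigenvalueP[v vE v0].
have [j vj] : exists j, v 0 j != 0.
  apply: contrapT => H; move/negP: v0; apply; apply/eqP/rowP => j; rewrite mxE.
  by apply: contrapT => /eqP vj; apply: H; exists j.
exists (fun i => normc (v 0 i)), j; split.
- by move=> i; exact: normc_ge0.
- rewrite lt_neqAle normc_ge0 andbT eq_sym; apply: contra vj.
  by move=> /eqP /ComplexField.Normc.eq0_normc ->.
move=> k; have vk : v *m map_mx (real_complex R) (B ^+ k) = z ^+ k *: v.
  elim: k => [|k IH].
    by rewrite !expr0 scale1r (_ : 1 = 1%:M :> 'M[R]_n)// map_mx1 mulmx1.
  by rewrite exprSr -mulmxE map_mxM mulmxA IH -scalemxAl vE scalerA exprSr.
have := congr1 (fun M : 'rV_n => normc (M 0 j)) vk.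
rewrite !mxE ComplexField.Normc.normcM normcX => <-.
apply: le_trans (normc_sum _ _) _; apply: ler_sum => i _.
by rewrite mxE ComplexField.Normc.normcM normc_real// power_ge0.
Qed.

Lemma spectral_radius_le1 (M : R) : (forall k i j, (B ^+ k) i j <= M) ->
  spectral_radius B <= 1.
Proof.
move=> HM; rewrite /spectral_radius; set S := [set _ | _ in _].
have [->|/set0P S0] := eqVneq S set0; first by rewrite sup0 ler01.
apply: ge_sup => // _ [z /= /eigenvalue_power[a [j [a0 aj H]]] <-].
rewrite leNgt; apply/negP => z1.
pose N := \sum_i a i * M.
have aM k : normc z ^+ k * a j <= N.
  by apply: le_trans (H k) _; apply: ler_sum => i _; rewrite ler_wpM2l.
have bern m : m%:R * (normc z - 1) <= normc z ^+ m.
  elim: m => [|m IH]; first by rewrite mul0r expr0.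
  have am : 1 <= normc z ^+ m by rewrite exprn_ege1// ltW.
  rewrite exprS -natr1; nra.
have z10 : 0 < (normc z - 1) * a j by rewrite mulr_gt0// subr_gt0.
have [m Nm] := archimedean_mul N z10.
have : m%:R * (normc z - 1) * a j <= N.
  by apply: le_trans (aM m); rewrite ler_wpM2r// ltW.
by rewrite leNgt -mulrA Nm.
Qed.

(** For |z| >= 1 the left-hand sides of the eigenvector inequalities would have a
    divergent sum.  The eigenvalues being finitely many, the strict bound passes
    to the supremum. *)
Lemma spectral_radius_lt1 (M : R) :
  (forall K i j, \sum_(k < K) (B ^+ k) i j <= M) -> spectral_radius B < 1.
Proof.
move=> HM; have lt1 z : eigenvalue BC z -> normc z < 1.
  move=> /eigenvalue_power[a [j [a0 aj H]]]; rewrite ltNge; apply/negP => z1.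
  pose N := \sum_i a i * M.
  have aM K : K%:R * a j <= N.
    apply: (@le_trans _ _ (\sum_(k < K) \sum_i a i * (B ^+ k) i j)).
      rewrite mulr_natl -[X in _ *+ X](card_ord K) -sumr_const.
      apply: ler_sum => k _; apply: le_trans (H k).
      by rewrite ler_peMl ?exprn_ege1// ltW.
    by rewrite exchange_big; apply: ler_sum => i _; rewrite -mulr_sumr ler_wpM2l.
  by have [m Nm] := archimedean_mul N aj; have := aM m; rewrite leNgt Nm.
have [rs rsE] := closed_field_poly_normal (char_poly BC).
have roots z : eigenvalue BC z -> z \in rs.
  rewrite eigenvalue_root_char rsE rootZ ?root_prod_XsubC//.
  by rewrite (monicP (char_poly_monic _)) oner_neq0.
rewrite /spectral_radius; set S := [set _ | _ in _].
have [->|/set0P S0] := eqVneq S set0; first by rewrite sup0 ltr01.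
pose m := \big[Num.max/0]_(z <- rs | eigenvalue BC z) normc z.
apply: (@le_lt_trans _ _ m).
  apply: ge_sup => // _ [z /= ez <-]; rewrite /m.
  by apply: le_bigmax_seq => //; exact: roots.
rewrite /m; elim/big_ind: _ => // u v u1 v1.
by rewrite gt_max u1 v1.
Qed.

End SpectralRadiusBounds.

(** * Transition matrices *)

Lemma le1_of_expR_bounds {R : realType} (b : R) k :
  (forall a, 0 < a -> b <= expR a ^+ k) -> b <= 1.
Proof.
move=> H; rewrite leNgt; apply/negP => b1.
have lb : 0 < ln b by rewrite ln_gt0.
have k1 : 0 < k.+1%:R :> R by rewrite ltr0n.
have := H (ln b / k.+1%:R) (divr_gt0 lb k1); rewrite -expRM_natl.
rewrite -{1}(@lnK _ b) ?posrE ?(lt_trans ltr01)// ler_expR leNgt => /negP; apply.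
by rewrite mulrCA -[ltRHS]mulr1 ltr_pM2l// ltr_pdivrMr// mul1r ltr_nat.
Qed.

Section Component.
Context {G : groupType} {H : set G} (D : decomposition H) (F : lifting D).
Variables (C : {set quoE D}) (C_comp : component F C).
Local Notation ev := (@enum_val _ (mem C)).

Lemma component_connect (e f : quoE D) : e \in C -> f \in C ->
  connect (transition_digraph F) e f.
Proof.
have [e0 _ ->] := C_comp; rewrite !inE => /andP[_ ee0] /andP[/andP[_ e0f] _].
exact: connect_trans ee0 e0f.
Qed.

Lemma component_between (e f g : quoE D) : e \in C -> g \in C ->
  transition_digraph F e f -> connect (transition_digraph F) f g -> f \in C.
Proof.
move=> + + ef fg; have [e0 _ ->] := C_comp.
rewrite !inE => /andP[/andP[_ e0e] _] /andP[_ ge0].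
rewrite (connect_trans fg ge0) andbT (connect_trans e0e (connect1 ef)) andbT.
by apply/asboolP; move/asboolP: ef => [].
Qed.

(** A path of the digraph joining two elements of a strongly connected component
    stays in the component. *)
Lemma component_irreducible {R : realType} (P : 'M[R]_#|C|) :
  (forall i j, 0 <= P i j) ->
  (forall i j, transition_digraph F (ev i) (ev j) -> 0 < P i j) ->
  forall i j, exists m, 0 < (P ^+ m) i j.
Proof.
move=> P0 Ppos i j.
have /connectP[p] := component_connect (enum_valP i) (enum_valP j).
elim: p i => [|e p IH] i /=.
  by move=> _ /esym/enum_val_inj <-; exists 0%N; rewrite expr0 mxE eqxx ltr01.
move=> /andP[ie ep] lst.
have eC : e \in C.
  by apply: component_between (enum_valP i) (enum_valP j) ie _; apply/connectP; exists p.
have ei : ev (enum_rank_in eC e) = e by rewrite enum_rankK_in.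
have [|//|m m0] := IH (enum_rank_in eC e); rewrite ?ei//.
exists m.+1; apply: (@lt_le_trans _ _ (P i (enum_rank_in eC e) * (P ^+ m) (enum_rank_in eC e) j)).
  by rewrite mulr_gt0// Ppos// ei.
by have := powerD_ge P0 1 m i (enum_rank_in eC e) j; rewrite expr1 add1n.
Qed.

End Component.

Section Node.
Context {R : realType} {X : metricType R} (Gam : set (isom X)) (x : X).
Variable d : R.
Hypotheses (d0 : 0 < d) (crit : forall s, d < s -> bounded_sums Gam (weight x s)).
Context {H : set (isom X)} (Hgroup : subgroup H) (HGam : H `<=` Gam).
Context (D : decomposition H) (F : lifting D) (C : {set quoE D}).
Local Notation ev := (@enum_val _ (mem C)).
Local Notation I := 'I_#|C|.
Implicit Types (lab : I -> I -> seq (set (isom X))) (e f : quoE D) (c : set (isom X)).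

Lemma system_summable lab (elt : I -> I -> set (isom X) -> isom X) (B : 'M[R]_#|C|) s :
  d < s -> (forall i j, uniq (lab i j)) ->
  (forall i j c, c \in lab i j -> allowed F (ev i) (ev j) c /\
    exists2 g, c g & elt i j c = (g * tau F (ev j))%g) ->
  (forall i j, 0 <= B i j) ->
  (forall i j, B i j <= \sum_(c <- lab i j) weight x s (elt i j c)) ->
  exists M, forall K i j, \sum_(k < K) (B ^+ k) i j <= M.
Proof.
move=> ds ulab labP B0 BW; have [M HM] := crit ds.
exists M; apply: (power_series_le Hgroup enum_val_inj ulab labP _ _ _ B0 BW HGam HM).
- exact: weight_ge0.
- by rewrite /weight isom1 mdistxx mulr0 oppr0 expR0.
- by move=> g h; apply: weightM; apply/ltW; apply: lt_trans ds.
Qed.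

Lemma transition_length_ge0 e f c : allowed F e f c -> 0 <= transition_length F x f c.
Proof.
move=> [_ [r [Hr rv] <-] _]; apply: lb_le_inf; last by move=> _ [g _ <-]; exact: mdist_ge0.
by exists (mdist x ((r * 1 * tau F f)%g x)), (r * 1)%g => //; exists 1%g => //;
  split; [exact: Hgroup.1|rewrite actE1].
Qed.

(** The length is an infimum, so a representative of excess at most [a] is used
    in place of a shortest one. *)
Lemma near_shortest e f c a : allowed F e f c -> 0 < a ->
  exists2 g, c g & mdist x ((g * tau F f)%g x) <= transition_length F x f c + a.
Proof.
move=> [_ [r [Hr rv] <-] _] a0.
have hi : has_inf [set mdist x ((g * tau F f)%g x) | g in left_coset F r f].
  split; last by exists 0 => _ [g _ <-]; exact: mdist_ge0.
  by exists (mdist x ((r * 1 * tau F f)%g x)), (r * 1)%g => //; exists 1%g => //;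
    split; [exact: Hgroup.1|rewrite actE1].
by have [_ [g cg <-] /ltW lt] := inf_adherent a0 hi; exists g.
Qed.

Definition truncated lab : 'M[R]_#|C| :=
  \matrix_(i, j) \sum_(c <- lab i j) expR (- (d * transition_length F x (ev j) c)).

Lemma truncated_ge0 lab i j : 0 <= truncated lab i j.
Proof. by rewrite mxE sumr_ge0// => c _; exact: expR_ge0. Qed.

(** Above [d] the loop sums are at most 1 because the powers are summable;
    finitely many exponentials are continuous in the exponent, and in the
    lengths of nearly shortest representatives. *)
Lemma truncated_loop_le1 lab : (forall i j, uniq (lab i j)) ->
  (forall i j c, c \in lab i j -> allowed F (ev i) (ev j) c) ->
  forall k i, (0 < k)%N -> (truncated lab ^+ k) i i <= 1.
Proof.
move=> ulab lab_al k i k0; apply: (@le1_of_expR_bounds _ _ k) => a a0.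
pose L j c := transition_length F x (ev j) c.
pose S := \sum_i \sum_j \sum_(c <- lab i j) `|L j c|.
have LS i' j' c : c \in lab i' j' -> L j' c <= S.
  move=> cl; apply: (le_trans (ler_norm _)); rewrite /S (bigD1 i')//=.
  rewrite ler_wpDr ?sumr_ge0// => [l _|]; first by rewrite !sumr_ge0// => ? _; rewrite sumr_ge0.
  rewrite (bigD1 j')//= ler_wpDr ?sumr_ge0// => [l _|]; first by rewrite sumr_ge0.
  by rewrite (bigD1_seq c)//= ler_wpDr// sumr_ge0.
have S0 : 0 <= S by rewrite !sumr_ge0// => ? _; rewrite sumr_ge0// => ? _; rewrite sumr_ge0.
(* The exponent [s] and the excess [b] of the representatives are such that
   s (L + b) <= d L + a for every length L <= S. *)
pose s := d + a / (2 * (S + 1)).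
have ds : d < s by rewrite /s ltrDl divr_gt0//; lra.
have s0 : 0 < s := lt_trans d0 ds.
pose b := a / (2 * s).
have b0 : 0 < b by rewrite divr_gt0//; lra.
have /choice[rep repP] : forall jc : I * set (isom X), exists g,
    (exists i, allowed F (ev i) (ev jc.1) jc.2) ->
    jc.2 g /\ mdist x ((g * tau F (ev jc.1))%g x) <= L jc.1 jc.2 + b.
  move=> [j c]; have [[i' al]|nal] := pselect (exists i, allowed F (ev i) (ev j) c).
    by have [g cg gL] := near_shortest al b0; exists g.
  by exists 1%g => /nal.
pose elt (i j : I) c := (rep (j, c) * tau F (ev j))%g.
have T0 := truncated_ge0 lab.
have eT0 i' j' : 0 <= (expR (- a) *: truncated lab) i' j'.
  by rewrite mxE mulr_ge0// expR_ge0.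
have [M HM] : exists M, forall K i j,
    \sum_(k < K) ((expR (- a) *: truncated lab) ^+ k) i j <= M.
  apply: (@system_summable lab elt _ s) => //.
  - move=> i' j c cl; have al := lab_al _ _ _ cl; split=> //.
    by exists (rep (j, c)) => //; apply: (repP (j, c) _).1; exists i'.
  - move=> i' j; rewrite !mxE mulr_sumr big_seq [leRHS]big_seq; apply: ler_sum => c cl.
    have al := lab_al _ _ _ cl.
    have [_ gL] := repP (j, c) (ex_intro _ i' al).
    rewrite -expRD ler_expR -opprD lerN2 -/(L j c) /elt.
    apply: (@le_trans _ _ (s * (L j c + b))); first by rewrite ler_wpM2l// ltW.
    have L0 : 0 <= L j c := transition_length_ge0 al.
    have sb : s * b = a / 2 by rewrite /b; field; rewrite lt0r_neq0.
    rewrite mulrDr sb {1}/s mulrDl.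
    have : a / (2 * (S + 1)) * L j c <= a / 2.
      have S1 : 0 < S + 1 by rewrite ltr_wpDl.
      have -> : a / (2 * (S + 1)) * L j c = a / 2 * (L j c / (S + 1)).
        by field; rewrite lt0r_neq0.
      apply: ler_piMr; first by rewrite divr_ge0// ltW.
      rewrite ler_pdivrMr// mul1r.
      by apply: le_trans (LS _ _ _ cl) _; rewrite lerDl.
    by move=> aL; rewrite -addrA [leRHS]addrC lerD2l [leRHS]splitr lerD2r.
have := loop_le1 eT0 (fun K => HM K i i) k0.
by rewrite powerZ expRN exprVn ler_pdivrMl ?exprn_gt0 ?expR_gt0// mulr1.
Qed.

Hypothesis C_comp : component F C.

Definition one_label i j : seq (set (isom X)) :=
  if pselect (exists c, allowed F (ev i) (ev j) c) is left al then [:: sval (cid al)]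
  else [::].

Lemma one_label_allowed i j c : c \in one_label i j -> allowed F (ev i) (ev j) c.
Proof.
rewrite /one_label; case: pselect => // al; rewrite inE => /eqP ->.
exact: (svalP (cid al)).
Qed.

Lemma one_label_uniq i j : uniq (one_label i j).
Proof. by rewrite /one_label; case: pselect. Qed.

Lemma one_label_pos i j : transition_digraph F (ev i) (ev j) -> 0 < truncated one_label i j.
Proof.
move=> /asboolP[_ _ al]; rewrite mxE /one_label; case: pselect => // al'.
by rewrite big_seq1 expR_gt0.
Qed.

(** Closing up with a return path from [j] to [i] turns the labels of the entry
    (i, j) into loops; the return path is counted with a weight that does not
    depend on the finite set of labels. *)
Lemma transition_entry_finite i j : (transition_entry F x d (ev i) (ev j) < +oo)%E.
Proof.
apply/(bounded_sums_esum [set c | allowed F (ev i) (ev j) c]) => [c|]; first exact: expR_ge0.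
have [m m0] := component_irreducible C_comp (truncated_ge0 one_label) one_label_pos j i.
exists ((truncated one_label ^+ m) j i)^-1 => A uA Aal.
pose lab i' j' := if (i' == i) && (j' == j) then undup (A ++ one_label i j)
  else one_label i' j'.
have lab_al i' j' c : c \in lab i' j' -> allowed F (ev i') (ev j') c.
  rewrite /lab; case: ifP => [/andP[/eqP -> /eqP ->]|_]; last exact: one_label_allowed.
  by rewrite mem_undup mem_cat => /orP[/Aal|/one_label_allowed].
have lab_u i' j' : uniq (lab i' j').
  by rewrite /lab; case: ifP => _; [exact: undup_uniq|exact: one_label_uniq].
have mono i' j' : 0 <= truncated one_label i' j' <= truncated lab i' j'.
  rewrite truncated_ge0/= !mxE; apply: sum_sub_le => [c||c cl]; first exact: expR_ge0.
    exact: one_label_uniq.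
  rewrite /lab; case: ifP => [/andP[/eqP i'E /eqP j'E]|//].
  by rewrite mem_undup mem_cat -i'E -j'E cl orbT.
have Aij : \sum_(c <- A) expR (- (d * transition_length F x (ev j) c)) <= truncated lab i j.
  rewrite mxE; apply: sum_sub_le => [c||c cA]; [exact: expR_ge0|by []|].
  by rewrite /lab !eqxx mem_undup mem_cat cA.
have lp := truncated_loop_le1 lab_u lab_al i (ltn0Sn m).
rewrite -[leRHS]mul1r ler_pdivlMr//; apply: le_trans lp.
apply: (@le_trans _ _ (truncated lab i j * (truncated lab ^+ m) j i)).
  apply: ler_pM => //; [by rewrite sumr_ge0// => c _; exact: expR_ge0|exact: ltW|].
  exact: power_le_mono.
by have := powerD_ge (truncated_ge0 lab) 1 m i j i; rewrite expr1 add1n.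
Qed.

Let K := transition_block F x C d.

Lemma transition_entry_ge0 e f : (0 <= transition_entry F x d e f)%E.
Proof. by apply: esum_ge0 => c _; rewrite lee_fin expR_ge0. Qed.

Lemma transition_blockE i j : (K i j)%:E = transition_entry F x d (ev i) (ev j).
Proof.
by rewrite mxE fineK// ge0_fin_numE ?transition_entry_ge0// transition_entry_finite.
Qed.

Lemma transition_block_ge0 i j : 0 <= K i j.
Proof. by rewrite -lee_fin transition_blockE transition_entry_ge0. Qed.

Lemma transition_block_pos i j : transition_digraph F (ev i) (ev j) -> 0 < K i j.
Proof.
move=> /asboolP[_ _ [c al]].
apply: (@lt_le_trans _ _ (expR (- (d * transition_length F x (ev j) c)))); first exact: expR_gt0.
rewrite -lee_fin transition_blockE /transition_entry.
have := @sum_le_esum R _ [set c | allowed F (ev i) (ev j) c]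
  (fun c => expR (- (d * transition_length F x (ev j) c))) [:: c].
rewrite big_seq1; apply=> // g.
by rewrite inE => /eqP ->.
Qed.

(** The entries are suprema of finite sums, so up to a factor exp(a) the matrix
    is dominated by a truncation. *)
Lemma transition_loop_le1 k i : (0 < k)%N -> (K ^+ k) i i <= 1.
Proof.
move=> k0; apply: (@le1_of_expR_bounds _ _ k) => a a0.
have /choice[lab0 lab0P] : forall ij : I * I, exists l, [/\ uniq l,
    forall c, c \in l -> allowed F (ev ij.1) (ev ij.2) c &
    expR (- a) * K ij.1 ij.2 <= \sum_(c <- l) expR (- (d * transition_length F x (ev ij.2) c))].
  move=> [i' j']; apply: contrapT => Hno.
  have K0 : 0 < K i' j'.
    rewrite lt_neqAle transition_block_ge0 andbT; apply/negP => /eqP KE; apply: Hno.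
    by exists [::]; split=> //=; rewrite big_nil -KE mulr0.
  have : K i' j' <= expR (- a) * K i' j'.
    rewrite -lee_fin [leLHS]transition_blockE; apply: ge_ereal_sup => _ [A [Af AA] <-].
    rewrite fsbig_finite// sumEFin lee_fin leNgt; apply/negP => lt; apply: Hno.
    exists (finmap.enum_fset (fset_set A)); split=> /=; [exact: finmap.fset_uniq| |exact: ltW].
    by move=> c; rewrite in_fset_set// inE => /AA.
  by rewrite ler_pMl// leNgt expR_lt1 oppr_lt0 a0.
pose lab i j := lab0 (i, j).
have lab_u i' j' : uniq (lab i' j') by have [] := lab0P (i', j').
have lab_al i' j' c : c \in lab i' j' -> allowed F (ev i') (ev j') c.
  by have [_ + _] := lab0P (i', j'); apply.
have mono i' j' : 0 <= (expR (- a) *: K) i' j' <= truncated lab i' j'.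
  rewrite !mxE; have [_ _ /= ] := lab0P (i', j'); rewrite !mxE => ->.
  by rewrite andbT mulr_ge0 ?expR_ge0// fine_ge0// transition_entry_ge0.
have := le_trans (power_le_mono mono k i i)
  (truncated_loop_le1 lab_u lab_al i k0).
by rewrite powerZ expRN exprVn ler_pdivrMl ?exprn_gt0 ?expR_gt0// mulr1.
Qed.

(** A return path from [j] to [i] turns the bound on diagonal entries of powers
    into a bound on all entries. *)
Lemma transition_radius_le1 : spectral_radius (transition_block F x C d) <= 1.
Proof.
have /choice[m mP] : forall ij : I * I, exists m, 0 < (K ^+ m) ij.2 ij.1.
  move=> [i j] /=.
  exact: (component_irreducible C_comp transition_block_ge0 transition_block_pos).
apply: (@spectral_radius_le1 _ _ _ transition_block_ge0
  (\sum_i \sum_j (1 + ((K ^+ m (i, j)) j i)^-1))) => k i j.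
apply: (@le_trans _ _ (1 + ((K ^+ m (i, j)) j i)^-1)); last first.
  have t0 i' j' : 0 <= 1 + ((K ^+ m (i', j')) j' i')^-1.
    by rewrite addr_ge0// invr_ge0 power_ge0//; exact: transition_block_ge0.
  rewrite (bigD1 i)//= ler_wpDr ?sumr_ge0// => [l _|]; first by rewrite sumr_ge0.
  by rewrite (bigD1 j)//= ler_wpDr// sumr_ge0.
have := powerD_ge transition_block_ge0 k (m (i, j)) i j i.
have lp : (K ^+ (k + m (i, j))) i i <= 1.
  have [->|] := posnP (k + m (i, j))%N; first by rewrite expr0 mxE eqxx.
  exact: transition_loop_le1.
move=> /le_trans/(_ lp).
by rewrite -ler_pdivlMr ?(mP (i, j))// mul1r => /le_trans; apply; rewrite lerDr.
Qed.

End Node.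

(** * Comparison matrices and hierarchies *)

Section ComparisonMatrix.
Context {R : realType} {X : metricType R} (X_cat : CAT_minus1 X).
Variables (Gam : set (isom X)) (x : X) (d : R).
Hypotheses (d0 : 0 < d) (crit : forall s, d < s -> bounded_sums Gam (weight x s)).
Context {H : set (isom X)} (Hgroup : subgroup H) (HGam : H `<=` Gam).
Context (D : decomposition H) (F : lifting D) (C : {set quoE D}).
Variable a : hyperbolic_choice F C.
Local Notation ev := (@enum_val _ (mem C)).

(** The displacement of the base point is at most the axis length, so the
    comparison matrix is dominated by the Poincare series. *)
Lemma comparison_radius_lt1 s : d < s -> spectral_radius (comparison_matrix x a s) < 1.
Proof.
move=> ds; have s0 : 0 < s := lt_trans d0 ds.
pose lab (i j : 'I_#|C|) := finmap.enum_fset (fset_set (chosen a (ev i) (ev j))).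
have fin i j : finite_set (chosen a (ev i) (ev j)).
  by apply: chosen_finite; exact: enum_valP.
have labE i j c : (c \in lab i j) -> chosen a (ev i) (ev j) c.
  by rewrite /lab in_fset_set// inE.
have BE i j : comparison_matrix x a s i j =
    \sum_(c <- lab i j) expR (- (s * axis_length x (chosen_rep a (ev i) (ev j) c))).
  by rewrite mxE fsbig_finite.
have B0 i j : 0 <= comparison_matrix x a s i j.
  by rewrite BE sumr_ge0// => c _; exact: expR_ge0.
have [M HM] : exists M, forall K i j,
    \sum_(k < K) (comparison_matrix x a s ^+ k) i j <= M.
  apply: (@system_summable _ _ Gam x d d0 crit H Hgroup HGam D F C lab
    (fun i j => chosen_rep a (ev i) (ev j)) _ s) => //.
  - by move=> i j; exact: finmap.fset_uniq.
  - move=> i j c /labE ac; have [iC jC] := (enum_valP i, enum_valP j).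
    split; first exact: chosen_allowed ac.
    have [r [h [_ -> Gh ->]]] := chosen_repE iC jC ac.
    by exists (r * h)%g => //; exists h.
  - move=> i j; rewrite BE big_seq [leRHS]big_seq; apply: ler_sum => c /labE ac.
    rewrite ler_expR lerN2 (ler_wpM2l (ltW s0))//.
    by apply: (mdist_le_axis_length X_cat); apply: chosen_hyperbolic ac; exact: enum_valP.
exact: (@spectral_radius_lt1 _ _ _ B0 M HM).
Qed.

Lemma critical_parameter_le : (critical_parameter x a <= d%:E)%E.
Proof.
apply/lee_addgt0Pr => b b0; rewrite -EFinD; apply: ereal_inf_lbound.
by exists (d + b) => //; split; [exact: addr_gt0|apply: comparison_radius_lt1; rewrite ltrDl].
Qed.

End ComparisonMatrix.

Lemma every_nonterminal_node_sub (G : groupType) (A : set G)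
    (P : forall H : set G, decomposition H -> Prop) :
  (forall (H : set G) (D : decomposition H), subgroup H -> H `<=` A -> P H D) ->
  forall (H : set G) (T : hierarchy H), subgroup H -> H `<=` A ->
    every_nonterminal_node P T.
Proof.
move=> HP H; elim=> [//|{}H D sel u uK ch IH] Hg HA /=; split; first exact: HP.
move=> v vs; apply: IH; last by move=> g [Hg' _]; exact: HA.
split=> [|g h [gH gu] [hH hu]]; first by split; [exact: Hg.1|rewrite actV1].
have hV : H h^-1%g by exact: (subgroupV Hg).
have hVu : actV h^-1%g (u v) = u v by rewrite -{1}hu -(actVM _ hV hH) mulVg actV1.
by split; [exact: Hg.2|rewrite (actVM _ gH hV) hVu].
Qed.

(** * Groups fixing an end *)

Section Buckets.
Context {R : realType} {T : choiceType}.

Lemma bucket_sum (l : seq T) (w : T -> R) (key : T -> nat) (a n : nat -> R) K :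
  (forall m, 0 <= a m) -> (forall f, f \in l -> (key f < K)%N) ->
  (forall f, f \in l -> w f <= a (key f)) ->
  (forall m, (count (fun f => key f == m) l)%:R <= n m) ->
  \sum_(f <- l) w f <= \sum_(m < K) n m * a m.
Proof.
move=> a0 lK wa ln.
apply: (@le_trans _ _ (\sum_(f <- l) \sum_(m < K) (key f == m)%:R * a m)).
  rewrite big_seq [leRHS]big_seq; apply: ler_sum => f fl.
  rewrite (bigD1 (Ordinal (lK f fl)))//= eqxx mul1r ler_wpDr ?wa// sumr_ge0// => m _.
  by rewrite mulr_ge0.
rewrite exchange_big/=; apply: ler_sum => m _; rewrite -mulr_suml ler_wpM2r//.
apply: le_trans (ln m); rewrite -natr_sum ler_nat -sum1_count [leqRHS]big_mkcond/=.
apply: leq_sum => f _. by case: eqP.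
Qed.

Lemma geometric_sum_le (z : R) K : 0 <= z -> z < 1 ->
  \sum_(m < K) z ^+ m <= (1 - z)^-1.
Proof.
move=> z0 z1; have z10 : 0 < 1 - z by rewrite subr_gt0.
rewrite -[leRHS]mul1r ler_pdivlMr// mulrC.
have -> : (1 - z) * \sum_(m < K) z ^+ m = 1 - z ^+ K.
  by rewrite -opprB mulNr -subrX1 opprB.
by rewrite gerBl exprn_ge0.
Qed.

Lemma seq_bound (l : seq T) (w : T -> R) : exists M, forall f, f \in l -> w f <= M.
Proof.
elim: l => [|a l [M HM]]; first by exists 0.
exists (Num.max (w a) M) => f; rewrite inE => /orP[/eqP ->|/HM fM].
  by rewrite le_max lexx.
by rewrite le_max fM orbT.
Qed.

End Buckets.


Section FixedEnd.
Context {R : realType} (X : metricType R).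
Hypothesis X_cat : CAT_minus1 X.
Implicit Types (g f h k : isom X) (c : ray X) (t : R).

Lemma isom_displacementV g y : mdist y ((g^-1)%g y) = mdist y (g y).
Proof. by rewrite -(isom_dist g) isomVK metric_sym. Qed.

(** For [S] large, [c S] and [g (c S)] stay at bounded distance.  The triangle
    with vertices g x, c S, g (c S) is thin near g x, and the one with vertices
    c S, x, g x is thin near c S; the point [g (c t)] passes from the first to the
    second at the cost of 9 + 9. *)
Lemma fixed_end_shift x g c t : c 0 = x -> asymptotic (ray_isom g c) c ->
  mdist x (g x) <= t ->
  exists2 u, `|u - t| <= mdist x (g x) & 0 <= u /\ mdist (g (c t)) (c u) <= 18.
Proof.
move=> c0 /asboolP[M HM] gt; set r := mdist x (g x) in gt *.
have r0 : 0 <= r by exact: mdist_ge0.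
have M0 : 0 <= M by apply: le_trans (HM 0 (lexx 0)); exact: mdist_ge0.
pose S := t + r + M + 1; have S0 : 0 <= S by rewrite /S; lra.
set y := g x; have [e ge] := X_cat.1 y (c S); set L := mdist y (c S) in ge.
have LS : `|L - S| <= r.
  have := mdist_ler_dist (c S) y x.
  rewrite (metric_sym (c S) y) -{1}c0 (metric_sym (c S)) mdist_ray0// -/L.
  by rewrite (metric_sym y x).
have {}LS : S - r <= L /\ L <= S + r by move: LS; rewrite ler_norml; lra.
have gray : geodesic (g \o c) y (g (c S)).
  by rewrite /y -c0; exact: geodesic_isom (geodesic_ray _ _).
have dS : mdist y (g (c S)) = S by rewrite isom_dist -c0 mdist_ray0.
have gS := HM S S0; rewrite /= in gS.
have t0 : 0 <= t by lra.
have h1 := thin_triangle X_cat gray ge t0.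
have {}h1 : mdist (g (c t)) (e t) <= 9.
  by apply: h1; rewrite /gromov dS -/L /S in LS gS *; lra.
have gr := geodesic_rev ge; have gr' := geodesic_rev (geodesic_ray c S0).
have v0 : 0 <= L - t by rewrite /S in LS; lra.
have := thin_triangle X_cat gr gr' v0; rewrite -/L mdist_ray0//.
rewrite (_ : L - (L - t) = t); last by ring.
move=> h2; have {}h2 : mdist (e t) (c (S - (L - t))) <= 9.
  apply: h2; rewrite /gromov c0 (metric_sym (c S) y) -/L (metric_sym (c S) x).
  by rewrite -{1}c0 mdist_ray0// (metric_sym y) -/r; lra.
exists (S - (L - t)); first by rewrite ler_norml; lra.
split; first by lra.
by have := metric_triangle (g (c t)) (e t) (c (S - (L - t))); lra.
Qed.

Variables (Gam : set (isom X)) (x : X).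
Hypothesis Gam_group : subgroup Gam.

(** Near orbit points [h x] far out along [c], each [f] acts like the shift of
    [c] by some [b f] with |b f| <= d(x, f x).  Local finiteness of the orbit
    around [h x] bounds the number of [f] with [b f] in a given unit interval, so
    the Poincare series is dominated by a geometric one. *)
Lemma conical_fixed_end_summable c C s : c 0 = x -> 0 <= C -> 0 < s ->
  (critical_exponent Gam x < +oo)%E ->
  (forall g, Gam g -> asymptotic (ray_isom g c) c) ->
  (forall T, exists2 h, Gam h & exists2 t, T <= t & mdist (h x) (c t) <= C) ->
  bounded_sums Gam (weight x s).
Proof.
move=> c0 C0 s0 fin fixed con.
have [N HN] := orbit_locally_finite (2 * (C + 18) + 1) fin.
have e1 : expR (- s) < 1 by rewrite expR_lt1 oppr_lt0.
exists ((2 * N)%:R * (1 - expR (- s))^-1) => l ul lG.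
have [T HT] := seq_bound l (fun f => mdist x (f x)).
have [h Gh [t Tt hc]] := con T.
have /choice[b Hb] : forall f, exists b, f \in l ->
    [/\ `|b| <= mdist x (f x), 0 <= t + b & mdist (f (h x)) (c (t + b)) <= C + 18].
  move=> f; have [fl|_] := boolP (f \in l); last by exists 0.
  have [u ut [u0 fu]] := fixed_end_shift c0 (fixed f (lG f fl)) (le_trans (HT f fl) Tt).
  exists (u - t) => _; rewrite (_ : t + (u - t) = u); last by ring.
  split=> //.
  by have := metric_triangle (f (h x)) (f (c t)) (c u); rewrite isom_dist; lra.
pose key f := Num.truncn `|b f|.
have kb f : (key f)%:R <= `|b f| < (key f)%:R + 1 by rewrite natr1; exact: truncn_itv.
have [K HK] := seq_bound l (fun f => `|b f|).
pose K' := (Num.truncn K).+1.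
(* Elements shifting by nearly the same amount differ, after conjugation by [h],
   by elements of small displacement. *)
have same (P : pred (isom X)) :
    (forall f f', P f -> P f' -> f \in l -> f' \in l -> `|b f - b f'| <= 1) ->
    (count P l <= N)%N.
  move=> HP; rewrite -size_filter.
  have : uniq ([seq f <- l | P f]) by exact: filter_uniq.
  have : {subset [seq f <- l | P f] <= l} by move=> f; rewrite mem_filter => /andP[].
  have : all P ([seq f <- l | P f]) by exact: filter_all.
  case: ([seq f <- l | P f]) => // f0 l' /andP[Pf0 /allP Pl'] sub ul'.
  pose conj f := (h^-1 * (f0^-1 * f) * h)%g.
  rewrite -(size_map conj (f0 :: l')).
  have f0l : f0 \in l by apply: sub; rewrite mem_head.
  apply: HN.
  - rewrite map_inj_uniq// => f f' /mulIg/mulgI/mulgI //.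
  - move=> _ /mapP[f fl ->]; have Gf := lG f (sub f fl); have Gf0 := lG f0 f0l.
    apply: (subgroupM Gam_group) => //; apply: (subgroupM Gam_group).
      exact: subgroupV.
    by apply: (subgroupM Gam_group) => //; exact: subgroupV.
  - move=> _ /mapP[f fl ->]; have fl' := sub f fl.
    have Pf : P f by move: fl; rewrite inE => /orP[/eqP ->//|/Pl'].
    have bb := HP f0 f Pf0 Pf f0l fl'.
    rewrite -(isom_dist h) -(isom_dist f0) /conj !isomM !isomVK.
    have [_ p1 h1] := Hb f0 f0l; have [_ p2 h2] := Hb f fl'.
    have := metric_triangle (f0 (h x)) (c (t + b f0)) (f (h x)).
    have := metric_triangle (c (t + b f0)) (c (t + b f)) (f (h x)).
    rewrite ray_dist// (_ : t + b f0 - (t + b f) = b f0 - b f); last by ring.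
    by rewrite (metric_sym (c (t + b f))); lra.
apply: (@le_trans _ _ (\sum_(m < K') (2 * N)%:R * expR (- s) ^+ m)); last first.
  by rewrite -mulr_sumr ler_wpM2l// geometric_sum_le// expR_ge0.
apply: (@bucket_sum _ _ l (weight x s) key (fun m => expR (- s) ^+ m) (fun=> (2 * N)%:R)).
- by move=> m; rewrite exprn_ge0// expR_ge0.
- move=> f fl; rewrite /K' truncn_lt_nat// ; apply: le_lt_trans (HK f fl) _.
  exact: truncnS_gt.
- move=> f fl; rewrite -expRM_natl ler_expR mulrN lerN2 [leLHS]mulrC (ler_wpM2l (ltW s0))//.
  by have [bf _ _] := Hb f fl; have /andP[kf _] := kb f; exact: le_trans kf bf.
- move=> m; rewrite ler_nat mul2n -addnn.
  pose P f := (key f == m) && (0 <= b f); pose Q f := (key f == m) && (b f < 0).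
  apply: (@leq_trans (count (predU P Q) l)).
    by apply: sub_count => f /= kf; rewrite /P /Q kf/=; case: leP.
  apply: leq_trans (leq_addr (count (predI P Q) l) _) _; rewrite count_predUI.
  apply: leq_add; apply: same => f f' /andP[/eqP kf bf] /andP[/eqP kf' bf'] _ _.
    have := kb f; have := kb f'; rewrite kf kf' (ger0_norm bf) (ger0_norm bf').
    by rewrite ler_norml; lra.
  have := kb f; have := kb f'; rewrite kf kf' (ltr0_norm bf) (ltr0_norm bf').
  by rewrite ler_norml; lra.
Qed.

(** A limit point other than the end of [c] is approached by orbit points [k x]
    that leave [c] at bounded distance from [x]; seen from [k x], the base point
    lies near the translate of [c], so the points [k^-1 x] lie near [c]. *)
Lemma other_limit_point_conical c zeta : c 0 = x ->
  (forall g, Gam g -> asymptotic (ray_isom g c) c) ->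
  limit_set Gam x zeta -> ~~ asymptotic c (repr zeta : ray X) ->
  exists2 C, 0 <= C & forall T, exists2 h, Gam h &
    exists2 t, T <= t & mdist (h x) (c t) <= C.
Proof.
move=> c0 fixed [k [Gk kz]] nas.
have [K HK] := not_asymptotic_gromov X_cat x nas.
have K0 : 0 <= K.
  by apply: le_trans (HK 0 0 (lexx _) (lexx _)); exact: gromov_ge0.
exists (2 * (K + 10) + 36) => [|T]; first by lra.
pose M := Num.max (K + 10) T.
have MK : K + 10 <= M by rewrite le_max lexx.
have MT : T <= M by rewrite le_max lexx orbT.
have [[A B] /= [[n0 _ An] [t0 [_ Bt]]] AB] := kz M.
pose n := n0; have nA : A n by apply: An => /=.
pose t := Num.max 0 (t0 + 1).
have t00 : 0 <= t by rewrite le_max lexx.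
have tB : B t by apply: Bt; rewrite lt_max ltrDl ltr01 orbT.
have kzt : M <= gromov x (k n x) ((repr zeta : ray X) t) := AB (n, t) (conj nA tB).
set l := mdist x (k n x).
have Ml : M <= l by apply: le_trans kzt _; exact: gromov_le_dist.
have kc u : 0 <= u -> gromov x (k n x) (c u) <= K + 10.
  move=> u0; rewrite leNgt; apply/negP => big.
  have := gromov_hyperbolic X_cat (m := K + 10) (p := x) (a := c u) (b := k n x)
    (d := (repr zeta : ray X) t); rewrite gromovC => /(_ (ltW big) (le_trans MK kzt)).
  by have := HK u t u0 t00; lra.
exists (k n)^-1%g; first exact: (subgroupV Gam_group).
set h := (k n)^-1%g; exists l; first exact: le_trans MT Ml.
have l0 : 0 <= l by exact: mdist_ge0.
have hx : mdist x (h x) = l by rewrite isom_displacementV.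
have [M' HM'] := asboolP _ (fixed h (subgroupV Gam_group (Gk n))).
pose S := l + (mdist x (h x) + M') / 2.
have M'0 : 0 <= M' by apply: le_trans (HM' 0 (lexx 0)); exact: mdist_ge0.
have S0 : 0 <= S by rewrite /S hx; lra.
have lS : l <= S by rewrite /S hx; lra.
have g1 : l - (K + 10) <= gromov x (h x) (h (c S)).
  rewrite gromov_swap hx lerD2l lerN2 -(gromov_isom (k n)) /h !isomVK.
  exact: kc.
have g2 : l - (K + 10) <= gromov x (h (c S)) (c S).
  have := asymptotic_gromov x HM' S0 S0; rewrite /= c0 minxx mdistxx.
  by rewrite /S; lra.
have g3 := gromov_hyperbolic X_cat g1 g2.
have g4 : l - (K + 10) - 9 <= gromov x (c S) (c l).
  have := mdist_ray0 c S0; have := mdist_ray0 c l0; rewrite c0 /gromov ray_dist// => -> ->.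
  by rewrite ger0_norm; lra.
have := gromov_hyperbolic X_cat g3 g4; rewrite /gromov hx -{1}c0 (mdist_ray0 c l0); lra.
Qed.

(** A second limit point would make a common fixed end conical, and the Poincare
    series would then converge at every positive exponent. *)
Lemma no_common_fixed_end c : c 0 = x ->
  (0 < critical_exponent Gam x)%E -> (critical_exponent Gam x < +oo)%E ->
  nonelementary Gam x ->
  exists2 g, Gam g & ~~ asymptotic (ray_isom g c) c.
Proof.
move=> c0 pos fin [xi [eta [_ [Lxi Leta _ [xe _ _]]]]].
apply: contrapT => Hno.
have fixed g : Gam g -> asymptotic (ray_isom g c) c.
  by move=> Gg; apply: contrapT => /negP nas; apply: Hno; exists g.
have [zeta Lz nas] : exists2 zeta, limit_set Gam x zeta & ~~ asymptotic c (repr zeta : ray X).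
  apply: contrapT => Hz; apply: xe.
  have as_ z : limit_set Gam x z -> asymptotic c (repr z : ray X).
    by move=> Lz; apply: contrapT => /negP nas; apply: Hz; exists z.
  rewrite -(reprK xi) -(reprK eta); apply/eqmodP => /=.
  by apply: (asymptotic_trans (y := c)); [rewrite asymptotic_sym|]; exact: as_.
have [C C0 con] := other_limit_point_conical c0 fixed Lz nas.
have le0 s : 0 < s -> (critical_exponent Gam x <= s%:E)%E.
  move=> s0; apply: critical_exponent_le => //.
  exact: conical_fixed_end_summable c0 C0 s0 fin fixed con.
have : (critical_exponent Gam x <= 0)%E.
  by apply/lee_addgt0Pr => e e0; rewrite add0e; exact: le0.
by rewrite leNgt pos.
Qed.

End FixedEnd.

(** * Schottky sets *)

Section SchottkySet.
Context {R : realType} (X : metricType R).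
Hypotheses (X_proper : proper_space X) (X_cat : CAT_minus1 X).
Variables (Gam : set (isom X)) (x : X).
Hypotheses (Gam_group : subgroup Gam).
Hypotheses (pos : (0 < critical_exponent Gam x)%E)
  (fin : (critical_exponent Gam x < +oo)%E).
Implicit Types (g h k : isom X) (c : ray X) (s : R) (A B : set (isom X)).

(** Below the critical exponent the sets of elements with convergent sum form a
    proper ideal; an ultrafilter avoiding it singles out a forward and a
    backward limit direction. *)
Lemma divergent_ultrafilter s : ~ bounded_sums Gam (weight x s) -> 0 <= s ->
  exists U : set_system (isom X), [/\ UltraFilter U, U Gam,
    forall A, U A -> ~ bounded_sums (Gam `&` A) (weight x s) &
    forall r : R, U [set g | r <= mdist x (g x)]].
Proof.
move=> div s0.
pose F := [set A | bounded_sums (Gam `&` ~` A) (weight x s)].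
have FF : ProperFilter F.
  split; first by rewrite /F/= setC0 setIT.
  split; rewrite /F/=.
  - by rewrite setCT setI0; exists 0 => -[|g l] _ lA; [rewrite big_nil|have := lA g (mem_head _ _)].
  - by move=> P Q FP FQ; have := bounded_sumsU FP FQ; rewrite -setIUr -setCI.
  - by move=> P Q PQ; apply: bounded_sums_sub => g [Gg nQ]; split=> // /PQ.
have [U [UU FU]] := ultraFilterLemma FF.
exists U; split=> //.
- by apply: FU; rewrite /F/= setICr; exists 0 => -[|g l] _ lA;
    [rewrite big_nil|have := lA g (mem_head _ _)].
- move=> A UA bA; have : U (~` A) by apply: FU; rewrite /F/= setCK.
  by move=> UnA; have := filter_ex (filterI UA UnA); rewrite setICr => -[].
- move=> r; apply: FU; rewrite /F/=.
  have [N HN] := orbit_locally_finite r fin.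
  exists N%:R => l ul lA; apply: le_trans (sum_le_size (a := 1) _) _.
    move=> g _; rewrite /weight -[leRHS]expR0 ler_expR oppr_le0.
    by rewrite mulr_ge0// mdist_ge0.
  rewrite mulr1 ler_nat; apply: HN => // g /lA[Gg] //=.
  by move=> /negP; rewrite -ltNge => /ltW.
Qed.

(** If the forward and backward directions have the same end, a translate [k]
    separates them. *)
Lemma divergent_transverse s : nonelementary Gam x ->
  ~ bounded_sums Gam (weight x s) -> 0 <= s ->
  exists C B, [/\ 0 <= C, B `<=` Gam, ~ bounded_sums B (weight x s) &
    forall g h, B g -> B h -> gromov x (g x) ((h^-1)%g x) <= C].
Proof.
move=> nonel div s0.
have [U [UU UG Udiv Uoo]] := divergent_ultrafilter div s0.
have [c c0 cU] := limit_ray X_proper X_cat UU Uoo.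
have Uoo' (r : R) : U [set g : isom X | r <= mdist x ((g^-1)%g x)].
  by apply: filterS (Uoo r) => g /=; rewrite isom_displacementV.
have [c' c'0 c'U] := limit_ray X_proper X_cat UU Uoo'.
have [k Gk nas] : exists2 k, Gam k & ~~ asymptotic (ray_isom k c) c'.
  have [cc'|ncc'] := boolP (asymptotic c c'); last first.
    exists 1%g; first exact: Gam_group.1.
    apply: contra ncc' => /asboolP[M HM]; apply/asboolP; exists M => t t0.
    exact: HM.
  have [k Gk nas] := no_common_fixed_end X_cat Gam_group c0 pos fin nonel.
  exists k => //; apply: contra nas => kc'; apply: asymptotic_trans kc' _.
  by rewrite asymptotic_sym.
have [K HK] := not_asymptotic_gromov X_cat x nas.
have K0 : 0 <= K.
  by apply: le_trans (HK 0 0 (lexx _) (lexx _)); exact: gromov_ge0.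
set r := mdist x (k x); have r0 : 0 <= r by exact: mdist_ge0.
(* The excess over K + r absorbs two hyperbolicity constants. *)
pose t := K + r + 30; have t0 : 0 <= t by rewrite /t; lra.
pose A := Gam `&` ([set g : isom X | t - 1 <= gromov x (g x) (c t)] `&`
  [set g : isom X | t - 1 <= gromov x ((g^-1)%g x) (c' t)]).
have dA : ~ bounded_sums A (weight x s).
  by apply: Udiv; apply: filterI; [exact: cU|exact: c'U].
exists (K + 29), [set (k * g)%g | g in A]; split.
- lra.
- by move=> _ [g [Gg _] <-]; exact: (subgroupM Gam_group).
- move=> [M HM]; apply: dA; exists (M / weight x s k) => l ul lA.
  rewrite ler_pdivlMr ?weight_gt0// mulrC mulr_sumr.
  apply: (@le_trans _ _ (\sum_(g <- [seq (k * g)%g | g <- l]) weight x s g)).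
    by rewrite big_map; apply: ler_sum => g _; exact: weightM.
  apply: HM; first by rewrite map_inj_uniq//; exact: mulgI.
  by move=> _ /mapP[g gl ->]; exists g => //; exact: lA.
move=> _ _ [g [Gg [Ag _]] <-] [h [Gh [_ Ah]] <-].
rewrite leNgt; apply/negP => big.
have h1 : K + 29 <= gromov x (ray_isom k c t) ((k * g)%g x).
  have b := gromov_base (k x) x (k (g x)) (k (c t)).
  rewrite gromov_isom (metric_sym (k x)) -/r in b.
  have Agt : t - 1 <= gromov x (g x) (c t) := Ag.
  by rewrite gromovC; change (K + 29 <= gromov x (k (g x)) (k (c t))); rewrite /t in b Agt *; lra.
have h2 : K + 29 <= gromov x (((k * h)^-1)%g x) (c' t).
  have b := gromov_move x (c' t) ((h^-1)%g x) (((k * h)^-1)%g x).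
  rewrite [X in _ <= _ + X](_ : _ = r) in b; last first.
    by rewrite invgM isomM isom_dist isom_displacementV.
  have Aht : t - 1 <= gromov x ((h^-1)%g x) (c' t) := Ah.
  by rewrite !(gromovC x (c' t)) /t in b Aht *; lra.
have := HK t t t0 t0.
have h3 : K + 29 - 9 <= gromov x (((k * h)^-1)%g x) (c' t) by lra.
by have := gromov_hyperbolic X_cat (gromov_hyperbolic X_cat h1 (ltW big)) h3; lra.
Qed.

(** Choose greedily: at most [N] elements are discarded for being [r]-close to a
    chosen one. *)
Lemma separated_subset (r : R) : 0 <= r -> exists N : nat, forall l, (forall g, g \in l -> Gam g) ->
  uniq l -> exists S, [/\ uniq S, {subset S <= l}, (size l <= N * size S)%N &
    forall g h, g \in S -> h \in S -> g != h -> r < mdist (g x) (h x)].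
Proof.
move=> r0; have [N HN] := orbit_locally_finite r fin; exists N => l.
have [n] := ubnP (size l); elim: n l => // n IH [|a l] ln lG ul.
  by exists [::]; split.
pose near g := mdist (a x) (g x) <= r.
have [||| S [uS Sl lS sep]] := IH [seq g <- l | ~~ near g].
- by rewrite size_filter; apply: leq_ltn_trans (count_size _ _) _.
- by move=> g; rewrite mem_filter => /andP[_ gl]; apply: lG; rewrite inE gl orbT.
- by rewrite filter_uniq//; case/andP: ul.
have Sfar g : g \in S -> r < mdist (a x) (g x) /\ g \in l.
  by move=> /Sl; rewrite mem_filter /near -ltNge => /andP.
have aS : a \notin S by apply/negP => /Sfar[_]; apply/negP; case/andP: ul.
exists (a :: S); split.
- by rewrite /= aS.
- move=> g; rewrite !inE => /orP[->//|/Sfar[_ ->]]; exact: orbT.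
- rewrite /= mulnS.
  have -> : (size l).+1 = (count near (a :: l) + count (predC near) (a :: l))%N.
    by rewrite count_predC.
  apply: leq_add.
    rewrite -size_filter; set l' := [seq g <- a :: l | near g].
    rewrite -(size_map (fun g => a^-1 * g)%g l'); apply: HN.
    + by rewrite map_inj_uniq ?filter_uniq//; exact: mulgI.
    + move=> _ /mapP[g gl ->]; apply: (subgroupM Gam_group).
        by apply: (subgroupV Gam_group); apply: lG; rewrite mem_head.
      by apply: lG; move: gl; rewrite mem_filter => /andP[].
    + move=> _ /mapP[g gl ->]; rewrite isomM -(isom_dist a) isomVK.
      by move: gl; rewrite mem_filter => /andP[].
  by rewrite /= /near mdistxx r0 add0n -size_filter.
- move=> g h; rewrite !inE => /orP[/eqP ->|gS] /orP[/eqP ->|hS] gh; last exact: sep.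
  + by rewrite eqxx in gh.
  + exact: (Sfar h hS).1.
  + by rewrite metric_sym; exact: (Sfar g gS).1.
Qed.

(** If all annuli beyond [n0] had fewer separated elements, the sum over [B] at
    [s] would be dominated by geometric series of ratios exp(- s) and
    exp(s' - s). *)
Lemma separated_annulus B s s' (r : R) n0 : B `<=` Gam -> 0 < s' -> s' < s ->
  0 <= r -> ~ bounded_sums B (weight x s) ->
  exists n S, [/\ (n0 <= n)%N, uniq S,
    forall g, g \in S -> B g /\ n%:R <= mdist x (g x) < n%:R + 1,
    forall g h, g \in S -> h \in S -> g != h -> r < mdist (g x) (h x) &
    expR (s' * (n%:R + 1)) <= (size S)%:R].
Proof.
move=> BG s'0 ss' r0 div; apply: contrapT => Hno; apply: div.
have [N HN] := separated_subset r0.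
have [N0 HN0] := orbit_locally_finite n0%:R fin.
have s0 : 0 < s := lt_trans s'0 ss'.
(* The bound [n m] on the size of the annulus at [m] has one term for m < n0 and
   one for the other annuli. *)
pose n m : R := N0%:R + N%:R * expR (s' * (m%:R + 1)).
pose z := expR (- s); pose z' := expR (- (s - s')).
have z1 : z < 1 by rewrite expR_lt1 oppr_lt0.
have z'1 : z' < 1 by rewrite expR_lt1 oppr_lt0 subr_gt0.
exists (N0%:R * (1 - z)^-1 + N%:R * expR s' * (1 - z')^-1) => l ul lB.
pose key g := Num.truncn (mdist x (g x)).
have kb g : (key g)%:R <= mdist x (g x) < (key g)%:R + 1.
  by rewrite natr1; apply: truncn_itv; exact: mdist_ge0.
have [K HK] := seq_bound l (fun g => mdist x (g x)).
apply: (@le_trans _ _ (\sum_(m < (Num.truncn K).+1) n m * z ^+ m)).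
  apply: (@bucket_sum _ _ l (weight x s) key (fun m => z ^+ m) n).
  - by move=> m; rewrite exprn_ge0// expR_ge0.
  - move=> g gl; rewrite truncn_lt_nat ?mdist_ge0//.
    by apply: le_lt_trans (HK g gl) _; exact: truncnS_gt.
  - move=> g gl; rewrite /z -expRM_natl ler_expR mulrN lerN2 [leLHS]mulrC.
    by rewrite (ler_wpM2l (ltW s0))//; have /andP[] := kb g.
  - move=> m; rewrite -size_filter; set l' := [seq g <- l | key g == m].
    have l'P g : g \in l' -> B g /\ m%:R <= mdist x (g x) < m%:R + 1.
      by rewrite mem_filter => /andP[/eqP <- gl]; split; [exact: lB|exact: kb].
    have ul' : uniq l' by exact: filter_uniq.
    have l'G g : g \in l' -> Gam g by move=> /l'P[/BG].
    have [mn|nm] := ltnP m n0.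
      rewrite /n ler_wpDr ?mulr_ge0 ?expR_ge0// ler_nat; apply: HN0 => // g /l'P[_].
      move=> /andP[_ /ltW gm]; apply: le_trans gm _; rewrite natr1 ler_nat; exact: mn.
    have [S [uS Sl lS sep]] := HN l' l'G ul'.
    have Slt : (size S)%:R <= expR (s' * (m%:R + 1)).
      rewrite leNgt; apply/negP => /ltW big; apply: Hno; exists m, S; split=> //.
      by move=> g /Sl /l'P.
    rewrite /n ler_wpDl//; apply: (@le_trans _ _ (N%:R * (size S)%:R)).
      by rewrite -natrM ler_nat.
    by rewrite ler_wpM2l.
rewrite [leLHS](_ : _ = \sum_(m < (Num.truncn K).+1) N0%:R * z ^+ m +
    \sum_(m < (Num.truncn K).+1) N%:R * expR s' * z' ^+ m).
  rewrite -!mulr_sumr; apply: lerD; apply: ler_wpM2l.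
  - by [].
  - by apply: geometric_sum_le => //; exact: expR_ge0.
  - by rewrite mulr_ge0// expR_ge0.
  - by apply: geometric_sum_le => //; exact: expR_ge0.
rewrite -big_split/=; apply: eq_bigr => m _; rewrite /n mulrDl; congr (_ + _).
rewrite -!mulrA; congr (_ * _).
by rewrite /z /z' -!expRM_natl -!expRD; congr expR; ring.
Qed.

End SchottkySet.

(** * Chains of orbit points and their limits *)

Section LocalToGlobal.
Context {R : realType} (X : metricType R) (X_cat : CAT_minus1 X).
Implicit Types (p a b e : X).

Lemma gromov_transfer p a b e (C : R) : gromov p a e <= C -> C + 9 < gromov p b e ->
  gromov p a b <= C + 9.
Proof.
move=> ae be; rewrite leNgt; apply/negP => ab.
pose m := Num.min (gromov p a b) (gromov p b e).
have m1 : m <= gromov p a b by rewrite ge_min lexx.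
have m2 : m <= gromov p b e by rewrite ge_min lexx orbT.
have mC : C + 9 < m by rewrite lt_min ab be.
by have := gromov_hyperbolic X_cat m1 m2; lra.
Qed.

Variables (y : nat -> X) (C n : R).
Hypotheses (C0 : 0 <= C) (Cn : 2 * C + 40 <= n).
Hypothesis y_far : forall m, n <= mdist (y m) (y m.+1).
Hypothesis y_turn : forall m, gromov (y m.+1) (y m) (y m.+2) <= C.

(** Each step is so long that the product seen from its origin is almost
    unaffected by everything after it. *)
Lemma chain_backward k j : gromov (y j.+1) (y j) (y (j.+2 + k)) <= C + 9.
Proof.
have [C_ge0 C_le] := (C0, Cn).
elim: k j => [|k IH] j; first by rewrite addn0; have := y_turn j; lra.
rewrite addnS -addSn; apply: gromov_transfer (y_turn j) _.
rewrite gromovC gromov_swap; have := IH j.+1; have := y_far j.+1; lra.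
Qed.

Lemma chain_forward k i : gromov (y (i + k).+1) (y i) (y (i + k).+2) <= C + 9.
Proof.
have [C_ge0 C_le] := (C0, Cn).
elim: k => [|k IH]; first by rewrite addn0; have := y_turn i; lra.
rewrite addnS; have t := y_turn (i + k).+1; rewrite gromovC in t.
rewrite gromovC; apply: gromov_transfer t _.
rewrite gromovC gromov_swap (metric_sym (y (i + k).+2)) (gromovC (y (i + k).+1)).
by have := y_far (i + k).+1; lra.
Qed.

Lemma chain_gromov k j : gromov (y j.+1) (y 0) (y (j.+2 + k)) <= C + 18.
Proof.
have [C_ge0 C_le] := (C0, Cn).
have f := chain_forward j 0; rewrite add0n in f.
case: k => [|k]; first by rewrite addn0; lra.
suff : gromov (y j.+1) (y 0) (y (j.+2 + k.+1)) <= (C + 9) + 9 by lra.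
apply: gromov_transfer f _; rewrite addnS -addSn.
rewrite gromovC gromov_swap; have := chain_backward k j.+1; have := y_far j.+1; lra.
Qed.

Lemma chain_dist m : m%:R <= mdist (y 0) (y m).
Proof.
have [C_ge0 C_le] := (C0, Cn).
elim: m => [|m IH]; first exact: mdist_ge0.
case: m IH => [|m] IH; first by have := y_far 0; lra.
rewrite -natr1; have := chain_forward m 0; rewrite add0n; have := y_far m.+1.
by rewrite /gromov (metric_sym (y m.+1) (y 0)); lra.
Qed.

Lemma chain_gromov_base k m : m.+1%:R - (C + 18) <= gromov (y 0) (y m.+1) (y (m.+2 + k)).
Proof.
by rewrite gromov_swap; have := chain_gromov k m; have := chain_dist m.+1; lra.
Qed.

Hypothesis X_proper : proper_space X.

(** The products of the points [y m] tend to infinity, so they converge to the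
    end of a ray from [y 0]; the final estimate passes from this ray to the chosen
    representative of its end. *)
Lemma chain_limit : exists xi : boundary X, converges_to_boundary (y 0) y xi.
Proof.
have [U [UU FU]] := ultraFilterLemma (eventually_filter : ProperFilter \oo).
have Uge N : U [set m | (N <= m)%N] by apply: FU; exists N.
have Ufar (r : R) : U [set m | r <= mdist (y 0) (y m)].
  have [N rN] : exists N : nat, r <= N%:R.
    exists (Num.truncn r).+1; exact/ltW/truncnS_gt.
  apply: filterS (Uge N) => m /= Nm; apply: le_trans (chain_dist m).
  by apply: le_trans rN _; rewrite ler_nat.
have [c c0 Uc] := limit_ray X_proper X_cat UU Ufar.
have yc m (t T : R) : 0 <= t -> T <= t - 1 -> T <= m.+1%:R - (C + 18) ->
    T - 9 <= gromov (y 0) (y m.+1) (c t).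
  move=> t0 Tt Tm.
  have [l [/= ml yl]] := filter_ex (filterI (Uge m.+2) (Uc t t0)).
  apply: (@gromov_hyperbolic _ _ X_cat _ _ (y l)); last exact: le_trans yl.
  by apply: le_trans Tm _; rewrite -(subnKC ml); exact: chain_gromov_base.
pose xi : boundary X := \pi_(boundary X) c.
exists xi.
have : asymptotic c (repr xi : ray X).
  by rewrite asymptotic_sym; have /eqmodP := reprK xi.
move=> /asboolP[M HM] T.
have M0 : 0 <= M by apply: le_trans (HM 0 (lexx 0)); exact: mdist_ge0.
set r : ray X := repr xi in HM *.
pose D := (mdist (y 0) (r 0) + M) / 2.
have D0 : 0 <= D by rewrite /D divr_ge0// addr_ge0// mdist_ge0.
have [N HN] : exists N : nat, T + 18 + (C + 18) <= N%:R.
  exists (Num.truncn (T + 18 + (C + 18))).+1; exact/ltW/truncnS_gt.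
exists ([set m | (N < m)%N], [set t | Num.max 0 (T + 19 + D) < t]).
  split=> /=; first by exists N.+1.
  by exists (Num.max 0 (T + 19 + D)); split=> //; exact: num_real.
move=> [m t] /= [Nm]; rewrite gt_max => /andP[/ltW t0 tT].
case: m Nm => // m Nm.
have h1 : T + 9 <= gromov (y 0) (y m.+1) (c t).
  suff : T + 18 - 9 <= gromov (y 0) (y m.+1) (c t) by lra.
  apply: yc => //; first by lra.
  have : N%:R <= m.+1%:R :> R by rewrite ler_nat ltnW.
  by lra.
have h2 : T + 9 <= gromov (y 0) (c t) (r t).
  have := asymptotic_gromov (y 0) HM t0 t0.
  by rewrite minxx c0 mdistxx add0r -/D; lra.
by have := gromov_hyperbolic X_cat h1 h2; lra.
Qed.

End LocalToGlobal.

Section BourdonLowerBound.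
Context {R : realType} (X : metricType R) (X_cat : CAT_minus1 X).
Implicit Types (x : X) (c : ray X).

Lemma ray_busemann_mono x c (s t : R) : 0 <= s -> s <= t ->
  s - mdist x (c s) <= t - mdist x (c t).
Proof.
move=> s0 st; have := metric_triangle x (c s) (c t).
by rewrite ray_dist// ?(le_trans s0)// ler0_norm; lra.
Qed.

Lemma rays_separation_mono c c' (s t : R) : 0 <= s -> s <= t ->
  2 * s - mdist (c s) (c' s) <= 2 * t - mdist (c t) (c' t).
Proof.
move=> s0 st; have := metric_triangle (c t) (c s) (c' t).
have := metric_triangle (c s) (c' s) (c' t).
have := metric_triangle (c s) (c t) (c' t).
have t0 := le_trans s0 st.
by rewrite !ray_dist// !(distrC t s) ler0_norm; lra.
Qed.

(** The Gromov product of two rays is a combination of three monotone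
    quantities, hence converges when it is bounded. *)
Lemma boundary_gromov_le x c c' (K T : R) :
  (forall t, T <= t -> gromov x (c t) (c' t) <= K) ->
  (lim ((gromov x (c t) (c' t))%:E @[t --> +oo%R]) <= K%:E)%E.
Proof.
move=> HK.
pose p (t : R) := Num.max t 0.
have p0 t : 0 <= p t by rewrite /p le_max lexx orbT.
have pm s t : s <= t -> p s <= p t.
  by move=> st; rewrite /p ge_max !le_max st lexx orbT.
have pE t : 0 <= t -> p t = t by move=> t0; rewrite /p; apply/max_idPl.
pose f (e : ray X) (t : R) : R := p t - mdist x (e (p t)).
pose g (t : R) : R := 2 * p t - mdist (c (p t)) (c' (p t)).
have fm (e : ray X) : nondecreasing_fun (f e).
  by move=> s t st; apply: ray_busemann_mono => //; exact: pm.
have fb (e : ray X) t : f e t <= mdist x (e 0).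
  have := metric_triangle (e 0) x (e (p t)).
  by rewrite mdist_ray0// (metric_sym (e 0)) /f; lra.
have gm : nondecreasing_fun g.
  by move=> s t st; apply: rays_separation_mono => //; exact: pm.
have gE t : 0 <= t -> gromov x (c t) (c' t) = (g t - f c t - f c' t) / 2.
  by move=> t0; rewrite /gromov /g /f pE//; field.
have fc (e : ray X) : f e r @[r --> +oo] --> sup (range (f e)).
  apply: nondecreasing_cvgr => //; exists (mdist x (e 0)) => _ [t _ <-]; exact: fb.
have gc : g r @[r --> +oo] --> sup (range g).
  apply: nondecreasing_cvgr => //.
  exists (2 * K + mdist x (c 0) + mdist x (c' 0)) => _ [t _ <-].
  pose t' := Num.max t (Num.max T 0).
  have tt' : t <= t' by rewrite /t' le_max lexx.
  have Tt' : T <= t' by rewrite /t' !le_max lexx orbT.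
  have t'0 : 0 <= t' by rewrite /t' !le_max lexx !orbT.
  have := gm _ _ tt'; have := HK _ Tt'; rewrite gE//.
  by have := fb c t'; have := fb c' t'; lra.
set l := (sup (range g) - sup (range (f c)) - sup (range (f c'))) / 2.
have cv : (g t - f c t - f c' t) / 2 @[t --> +oo] --> l.
  by apply: cvgM; [apply: cvgB; [exact: cvgB|]|exact: cvg_cst].
have cvE : (gromov x (c t) (c' t))%:E @[t --> +oo%R] --> l%:E.
  apply: cvg_EFin; first by near=> t.
  apply: cvg_trans cv; apply: near_eq_cvg; near=> t.
  by rewrite /= gE//; near: t; exact: nbhs_pinfty_ge.
apply: lime_le; first by apply/cvg_ex; exists l%:E.
near=> t; rewrite lee_fin; apply: HK; near: t; apply: nbhs_pinfty_ge; exact: num_real.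
Unshelve. all: by end_near. Qed.

(** The product of two ends exceeds that of points converging to them by at most
    two hyperbolicity constants. *)
Lemma bourdon_ge x (y z : nat -> X) xi eta (K : R) :
  converges_to_boundary x y xi -> converges_to_boundary x z eta ->
  (forall N, exists m l, [/\ (N <= m)%N, (N <= l)%N & gromov x (y m) (z l) <= K]) ->
  ((expR (- (K + 18)))%:E <= bourdon x xi eta)%E.
Proof.
move=> yxi zeta yz.
suff H : (boundary_gromov x xi eta <= (K + 18)%:E)%E.
  rewrite /bourdon (_ : (expR (- (K + 18)))%:E = expeR (- (K + 18)%:E))%E//.
  by rewrite lee_expeR leeN2.
have [[A B] /= [[n1 _ An] [t1 [_ Bt]]] AB] := yxi (K + 19).
have [[A' B'] /= [[n2 _ An'] [t2 [_ Bt']]] AB'] := zeta (K + 19).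
rewrite /boundary_gromov.
apply: (boundary_gromov_le (T := Num.max t1 t2 + 1)) => t tt.
have [m [l [ml ll yzK]]] := yz (maxn n1 n2).
have t1t : t1 < t by apply: lt_le_trans tt; rewrite ltr_pwDr// le_max lexx.
have t2t : t2 < t by apply: lt_le_trans tt; rewrite ltr_pwDr// le_max lexx orbT.
have h1 : K + 19 <= gromov x (y m) ((repr xi : ray X) t).
  apply: (AB (m, t)); split; [apply: An => /=|exact: Bt].
  by apply: leq_trans ml; exact: leq_maxl.
have h2 : K + 19 <= gromov x (z l) ((repr eta : ray X) t).
  apply: (AB' (l, t)); split; [apply: An' => /=|exact: Bt'].
  by apply: leq_trans ll; exact: leq_maxr.
rewrite leNgt; apply/negP => big.
set G := gromov x _ _ in big.
pose w := Num.min G (K + 19).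
have wG : w <= G by rewrite ge_min lexx.
have wK : w <= K + 19 by rewrite ge_min lexx orbT.
have Kw : K + 18 < w by rewrite lt_min big; lra.
have h3 := gromov_hyperbolic X_cat (le_trans wK h1) wG.
rewrite gromovC in h2.
have h4 : w - 9 <= gromov x ((repr eta : ray X) t) (z l).
  by apply: le_trans h2; lra.
by have := gromov_hyperbolic X_cat h3 h4; lra.
Qed.

End BourdonLowerBound.

(** * Lower bounds for the Hausdorff dimension *)

Section CylinderCover.
Context {R : realType} (b : nat) (W : nat -> seq 'I_b).
Hypothesis b_gt0 : (0 < b)%N.
Implicit Types (v w : seq 'I_b) (K : nat).
Let q : R := b%:R^-1.

Let q0 : 0 < q. Proof. by rewrite invr_gt0 ltr0n. Qed.
Let bq : b%:R * q = 1. Proof. by rewrite mulfV// pnatr_eq0 -lt0n. Qed.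

(** Sum of the uniform measures, relative to the cylinder of [v], of those among
    the first [K] cylinders that lie in it. *)
Definition load K v : R := \sum_(i < K | prefix v (W i)) q ^+ (size (W i) - size v).

Lemma load_le K K' v : (K <= K')%N -> load K v <= load K' v.
Proof.
move=> KK'; rewrite /load -!(big_mkord (fun i => prefix v (W i))
  (fun i => q ^+ (size (W i) - size v))).
rewrite [leRHS](big_cat_nat (n := K))//= lerDl sumr_ge0// => i _.
by rewrite exprn_ge0// ltW.
Qed.

(** A word that properly extends [v] extends exactly one child of [v]. *)
Lemma load_children K v : (forall i, W i <> v) ->
  load K v = q * \sum_(a < b) load K (rcons v a).
Proof.
move=> Wv; rewrite /load big_mkcond/=.
under [in RHS]eq_bigr => a _ do rewrite big_mkcond/=.
rewrite exchange_big/= mulr_sumr; apply: eq_bigr => i _.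
case: ifP => [/prefixP[[|a w] Wi]|nv].
- by case: (Wv i); rewrite Wi cats0.
- have pre a' : prefix (rcons v a') (W i) = (a' == a).
    by rewrite Wi -cats1 prefix_catr// eqxx /= prefix0s andbT.
  rewrite (bigD1 a)//= pre eqxx big1 => [|a' a'a]; last by rewrite pre (negPf a'a).
  by rewrite addr0 -exprS size_rcons Wi size_cat /= subnS addKn.
- rewrite big1 ?mulr0// => a _; case: ifP => // /prefixP[w Wi].
  by move/negP: nv; case; apply/prefixP; exists (a :: w); rewrite Wi cat_rcons.
Qed.

Variable theta : R.
Hypothesis theta1 : theta < 1.

(** The load of [v] is the average of those of its children.  As loads increase
    with [K], children that are all heavy are heavy at a common [K]. *)
Lemma light_child v : (forall K, load K v <= theta) ->
  exists a, forall K, load K (rcons v a) <= theta.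
Proof.
move=> Lv.
have Wv i : W i <> v.
  move=> Wi; have := Lv i.+1; rewrite /load big_mkcond big_ord_recr/= Wi prefix_refl subnn expr0.
  apply/negP; rewrite -ltNge; apply: (lt_le_trans theta1); rewrite lerDr sumr_ge0// => j _.
  by case: ifP => // _; rewrite exprn_ge0// ltW.
apply: contrapT => Hno.
have /choice[k Hk] : forall a, exists K, theta < load K (rcons v a).
  move=> a; apply: contrapT => HK; apply: Hno; exists a => K.
  by rewrite leNgt; apply/negP => lt; apply: HK; exists K.
have := Lv (\max_a k a)%N; rewrite load_children// leNgt => /negP; apply.
have -> : theta = q * \sum_(a < b) theta.
  by rewrite sumr_const card_ord -mulr_natl mulrA [q * _]mulrC bq mul1r.
rewrite ltr_pM2l//; apply: ltr_sum => [|a _].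
  by apply/hasP; exists (Ordinal b_gt0); rewrite ?mem_index_enum.
by apply: lt_le_trans (Hk a) _; apply: load_le; exact: leq_bigmax.
Qed.

(** One descends from the empty word along children of load at most [theta] < 1;
    no [W i] is met, since it would contribute 1 to its own load. *)
Lemma avoid_cylinders : (forall K, \sum_(i < K) q ^+ size (W i) <= theta) ->
  exists u : nat -> 'I_b, forall i, mkseq u (size (W i)) <> W i.
Proof.
move=> HW.
have /choice[nxt Hn] : forall v, exists a, (forall K, load K v <= theta) ->
    forall K, load K (rcons v a) <= theta.
  move=> v; have [Lv|nLv] := pselect (forall K, load K v <= theta).
    by have [a Ha] := light_child Lv; exists a.
  by exists (Ordinal b_gt0).
pose vs := fix vs k := if k is k'.+1 then rcons (vs k') (nxt (vs k')) else [::].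
have vsE k : mkseq (fun i => nxt (vs i)) k = vs k.
  by elim: k => // k IH; rewrite mkseqS IH.
have light k K : load K (vs k) <= theta.
  elim: k K => [|k IH] K; last exact: Hn.
  by apply: le_trans (HW K); rewrite /load; under eq_bigr do rewrite subn0; 
     under eq_bigl do rewrite prefix0s.
exists (fun i => nxt (vs i)) => i; rewrite vsE => Wi.
have := light (size (W i)) i.+1; rewrite Wi /load big_mkcond big_ord_recr/= prefix_refl.
rewrite subnn expr0 leNgt => /negP; apply; apply: (lt_le_trans theta1).
rewrite lerDr sumr_ge0// => j _.
by case: ifP => // _; rewrite exprn_ge0// ltW.
Qed.

End CylinderCover.

Section HausdorffLowerBound.
Context {R : realType} {Z : Type} (rho : Z -> Z -> \bar R) (A : set Z).
Variables (b : nat) (phi : (nat -> 'I_b) -> Z) (c q : R).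
Hypotheses (b_gt1 : (1 < b)%N) (c0 : 0 < c) (q0 : 0 < q).
Hypothesis phiA : forall u, A (phi u).
Hypothesis rho_ge : forall u v j, (forall i, (i < j)%N -> u i = v i) -> u j <> v j ->
  ((c * q ^+ j)%:E <= rho (phi u) (phi v))%E.

Lemma diameter_ge0 (B : set Z) : (0 <= diameter rho B)%E.
Proof. by apply: ereal_sup_ubound; left. Qed.

Lemma le_diameter (B : set Z) y z : B y -> B z -> (rho y z <= diameter rho B)%E.
Proof. by move=> By Bz; apply: ereal_sup_ubound; right; exists (y, z). Qed.

(** Let [m] be the first level with c q^m <= diam B.  Words with points in [B]
    agree below that level, and (diam B)^t >= c^t q^(t m) >= c^t b^-m.  If there
    is no such level, at most one word has its point in [B] and [e] pays for a
    long cylinder around it. *)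
Lemma cylinder_of_set (t e : R) (B : set Z) : 0 < t -> 1 <= b%:R * q `^ t -> 0 < e ->
  (poweR (diameter rho B) t < +oo)%E ->
  exists w : seq 'I_b, (forall u, B (phi u) -> mkseq u (size w) = w) /\
    b%:R^-1 ^+ size w <= fine (poweR (diameter rho B) t) / c `^ t + e.
Proof.
move=> t0 bq e0 Dfin.
have D0 : (0 <= poweR (diameter rho B) t)%E by exact: poweR_ge0.
have b0 : 0 < b%:R :> R by rewrite ltr0n ltnW.
have ct : 0 < c `^ t by exact: powR_gt0.
have cover m : (forall j, (j < m)%N -> ~ ((c * q ^+ j)%:E <= diameter rho B)%E) ->
    exists w : seq 'I_b, (forall u, B (phi u) -> mkseq u (size w) = w) /\ size w = m.
  move=> Hm; have [[u Bu]|nB] := pselect (exists u, B (phi u)); last first.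
    exists (nseq m (Ordinal (ltnW b_gt1))); split; last by rewrite size_nseq.
    by move=> u Bu; case: nB; exists u.
  exists (mkseq u m); rewrite size_mkseq; split=> // v Bv.
  apply: contrapT => uv.
  have [j jm] : exists2 j, (j < m)%N & v j <> u j.
    apply: contrapT => Hj; apply: uv; apply/eq_in_map => j; rewrite mem_iota add0n => jm.
    by apply: contrapT => vj; apply: Hj; exists j.
  move=> vj; have ex : exists j, v j != u j by exists j; exact/eqP.
  case: (ex_minnP ex) => k /eqP vk kmin.
  apply: (Hm k); first by apply: leq_ltn_trans (kmin j _) jm; exact/eqP.
  apply: le_trans (le_diameter Bv Bu); apply: rho_ge => // i ik.
  by apply: contrapT => /eqP vi; have := kmin i vi; rewrite leqNgt ik.
have [[j Hj]|Hno] := pselect (exists j, `[< ((c * q ^+ j)%:E <= diameter rho B)%E >]).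
  have ex : exists j, `[< ((c * q ^+ j)%:E <= diameter rho B)%E >] by exists j.
  case: (ex_minnP ex) => m /asboolP cm mmin.
  have [|w [wB wm]] := cover m.
    by move=> i im ci; have := mmin i (asboolT ci); rewrite leqNgt im.
  exists w; split=> //; rewrite wm.
  apply: (@le_trans _ _ (fine (poweR (diameter rho B) t) / c `^ t)); last by rewrite lerDl ltW.
  rewrite ler_pdivlMr// -lee_fin fineK ?ge0_fin_numE//.
  apply: (@le_trans _ _ (poweR (c * q ^+ m)%:E t)); last first.
    apply: (gt0_ler_poweR (ltW t0)) => //; rewrite in_itv/= leey andbT.
      by rewrite lee_fin mulr_ge0 ?exprn_ge0// ltW.
    exact: diameter_ge0.
  have qm0 : 0 <= q ^+ m by rewrite exprn_ge0// ltW.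
  rewrite poweR_EFin lee_fin (powRM _ (ltW c0) qm0) mulrC (ler_pM2l ct).
  have -> : (q ^+ m) `^ t = (q `^ t) ^+ m.
    by rewrite -(powR_mulrn _ (ltW q0)) -powRrM mulrC powRrM powR_mulrn// powR_ge0.
  apply: lerXn2r; rewrite ?nnegrE ?powR_ge0 ?invr_ge0 ?ler0n//.
  by rewrite -[b%:R^-1]mul1r ler_pdivrMr// mulrC.
have [m Hm] : exists m, b%:R^-1 ^+ m <= e.
  have [m em] := archimedean_mul e^-1 ltr01; exists m.
  rewrite exprVn -[leRHS]invrK lef_pV2 ?posrE ?exprn_gt0 ?invr_gt0//.
  rewrite mulr1 in em; apply: le_trans (ltW em) _.
  by rewrite -natrX ler_nat; apply: ltnW; exact: ltn_expl.
have [|w [wB wm]] := cover m.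
  by move=> j _ cj; apply: Hno; exists j; exact/asboolP.
exists w; split=> //; rewrite wm; apply: le_trans Hm _.
by rewrite lerDr divr_ge0 ?fine_ge0// ltW.
Qed.

(** A cover of small cost would give cylinders containing all infinite words, of
    total measure at most 1/4 + 1/2. *)
Lemma hausdorff_measure_neq0 (t : R) : 0 < t -> 1 <= b%:R * q `^ t ->
  hausdorff_measure rho t A <> 0%E.
Proof.
move=> t0 bq H0; have ct : 0 < c `^ t by exact: powR_gt0.
have /ereal_inf_lt[_ [U [AU _] <-] sum_lt] : (hausdorff_premeasure rho t 1 A < (c `^ t / 4)%:E)%E.
  apply: (@le_lt_trans _ _ 0%E); last by rewrite lte_fin divr_gt0.
  by rewrite -[leRHS]H0; apply: ereal_sup_ubound; exists 1 => //=; exact: ltr01.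
pose D i := poweR (diameter rho (U i)) t.
have D0 i : (0 <= D i)%E by exact: poweR_ge0.
have psum K : (\sum_(i < K) D i < (c `^ t / 4)%:E)%E.
  apply: le_lt_trans sum_lt; rewrite -(big_mkord xpredT D).
  by apply: nneseries_lim_ge => n _ _; exact: D0.
have Dfin i : (D i < +oo)%E.
  apply: le_lt_trans (lt_trans (psum i.+1) (ltry _)).
  by rewrite big_ord_recr/= leeDr// sume_ge0.
pose e i : R := 2^-1 ^+ i / 4.
have e0 i : 0 < e i by rewrite divr_gt0// exprn_gt0// invr_gt0.
have /choice[W HW] := fun i => cylinder_of_set t0 bq (e0 i) (Dfin i).
have [K|u Hu] := @avoid_cylinders R b W (ltnW b_gt1) (3 / 4) (ltac:(lra)).
  apply: (@le_trans _ _ (\sum_(i < K) (fine (D i) / c `^ t + e i))).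
    by apply: ler_sum => i _; exact: (HW i).2.
  rewrite big_split/= -mulr_suml /e -mulr_suml.
  have -> : 3 / 4 = 4^-1 + 2 / 4 :> R by field.
  apply: lerD.
    rewrite ler_pdivrMr// mulrC -lee_fin; apply: le_trans (ltW (psum K)).
    rewrite -sumEFin; apply: lee_sum => i _.
    by rewrite fineK// ge0_fin_numE; [exact: Dfin|exact: D0].
  rewrite ler_pM2r ?invr_gt0//; have := @geometric_sum_le R 2^-1 K.
  have -> : (1 - 2^-1)^-1 = 2 :> R by field.
  by apply; [rewrite invr_ge0|rewrite invf_lt1// ltr1n].
have [i _ Ui] := AU _ (phiA u).
exact: Hu i ((HW i).1 u Ui).
Qed.

Lemma hausdorff_dim_ge (s : R) : q < 1 -> 1 <= b%:R * q `^ s ->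
  (s%:E <= hausdorff_dim rho A)%E.
Proof.
move=> q1 bs; apply: le_ereal_inf_tmp => _ [t [t0 Ht] <-].
rewrite lee_fin leNgt; apply/negP => ts; apply: (hausdorff_measure_neq0 t0) Ht.
apply: le_trans bs _; rewrite ler_wpM2l//.
rewrite /powR (gt_eqF q0) ler_expR; apply: ler_wnM2r; last exact: ltW.
by apply: ln_le0; exact: ltW.
Qed.

End HausdorffLowerBound.

(** * The Bishop-Jones inequality *)

Section SchottkyCantorSet.
Context {R : realType} (X : metricType R).
Hypotheses (X_cat : CAT_minus1 X) (X_proper : proper_space X).
Variables (Gam : set (isom X)) (x : X) (Gam_group : subgroup Gam).
Variables (b : nat) (a : 'I_b -> isom X) (C n : R).
Hypotheses (C0 : 0 <= C) (Cn : 2 * C + 40 <= n).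
Hypothesis aGam : forall i, Gam (a i).
Hypothesis a_len : forall i, n <= mdist x (a i x) < n + 1.
Hypothesis a_turn : forall i j, gromov x (a i x) ((a j)^-1%g x) <= C.
Hypothesis a_sep : forall i j, i <> j -> 2 * C + 56 < mdist (a i x) (a j x).
Implicit Types (u v : nat -> 'I_b).

Fixpoint word_product u m : isom X :=
  if m is m'.+1 then (word_product u m' * a (u m'))%g else 1%g.

Let y u m : X := word_product u m x.

Lemma word_product_Gam u m : Gam (word_product u m).
Proof. by elim: m => [|m IH] /=; [exact: Gam_group.1|exact: (subgroupM Gam_group)]. Qed.

Let yS u m : y u m.+1 = word_product u m (a (u m) x).
Proof. by []. Qed.

Let y_step u m : mdist (y u m) (y u m.+1) = mdist x (a (u m) x).
Proof. by rewrite yS isom_dist. Qed.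

Let y_far u m : n <= mdist (y u m) (y u m.+1).
Proof. by rewrite y_step; have /andP[] := a_len (u m). Qed.

Let y_turn u m : gromov (y u m.+1) (y u m) (y u m.+2) <= C.
Proof.
have -> : y u m = word_product u m.+1 ((a (u m))^-1%g x).
  by rewrite [RHS]isomM isomVK.
by rewrite (yS u m.+1) gromov_isom gromovC.
Qed.

Lemma word_limit u : exists xi : boundary X, converges_to_boundary x (y u) xi.
Proof. exact: (chain_limit X_cat C0 Cn (y_far u) (y_turn u) X_proper). Qed.

Let y_dist u m : mdist x (y u m) <= m%:R * (n + 1).
Proof.
elim: m => [|m IH]; first by rewrite mdistxx mul0r.
rewrite -natr1 mulrDl mul1r; apply: le_trans (metric_triangle _ (y u m) _) _.
by apply: lerD => //; rewrite y_step; have /andP[_ /ltW] := a_len (u m).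
Qed.

(** Seen from the last common vertex, the two chains leave through distinct
    separated points at distance about [n]. *)
Lemma word_gromov_le u v j k l : (forall i, (i < j)%N -> u i = v i) -> u j <> v j ->
  gromov x (y u (j.+2 + k)) (y v (j.+2 + l)) <= j.+1%:R * (n + 1).
Proof.
move=> uv uvj; have C_le := Cn; have C_ge0 := C0.
have pj : word_product u j = word_product v j.
  elim: j uv {uvj k l} => //= j IH uv; rewrite IH ?uv// => i ij.
  by apply: uv; apply: leq_trans ij _.
have yj : y u j = y v j by rewrite /y pj.
apply: le_trans (gromov_base x (y u j) _ _) _.
rewrite -natr1 mulrDl mul1r addrC; apply: lerD; first exact: y_dist.
have near w k' : n - (C + 9) <= gromov (y w j) (y w j.+1) (y w (j.+2 + k')).
  rewrite gromov_swap; have := chain_backward X_cat C0 Cn (y_far w) (y_turn w) k' j.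
  by have := y_far w j; lra.
rewrite leNgt; apply/negP => big.
have hu := near u k; have hv := near v l; rewrite -yj gromovC in hv.
have big' : n - (C + 9) <= gromov (y u j) (y u (j.+2 + k)) (y v (j.+2 + l)) by lra.
have h1 := gromov_hyperbolic X_cat hu big'.
have h2 : n - (C + 9) - 9 <= gromov (y u j) (y v (j.+2 + l)) (y v j.+1) by lra.
have h3 := gromov_hyperbolic X_cat h1 h2.
have s1 : mdist (y u j) (y u j.+1) = mdist x (a (u j) x) := y_step u j.
have s2 : mdist (y u j) (y v j.+1) = mdist x (a (v j) x).
  by rewrite yj; exact: y_step.
have s3 : mdist (y u j.+1) (y v j.+1) = mdist (a (u j) x) (a (v j) x).
  by rewrite !yS pj isom_dist.
have := mdist_gromov (y u j) (y u j.+1) (y v j.+1); rewrite s1 s2 s3.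
have := a_sep uvj; have /andP[_] := a_len (u j); have /andP[_] := a_len (v j).
by lra.
Qed.

(** The limit points of infinite words form a Cantor set on which the Bourdon
    metric decays at most like exp(- (n+1)) per letter. *)
Lemma schottky_dim_ge (s : R) : (1 < b)%N -> expR (s * (n + 1)) <= b%:R ->
  (s%:E <= hausdorff_dim (bourdon x) (limit_set Gam x))%E.
Proof.
move=> b1 bs; have C_le := Cn; have C_ge0 := C0.
have /choice[phi Hphi] := word_limit.
apply: (@hausdorff_dim_ge _ _ _ _ b phi (expR (- (n + 19))) (expR (- (n + 1)))) => //.
- exact: expR_gt0.
- exact: expR_gt0.
- by move=> u; exists (word_product u); split; [exact: word_product_Gam|exact: Hphi].
- move=> u v j uv uvj.
  have -> : expR (- (n + 19)) * expR (- (n + 1)) ^+ j =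
            expR (- (j.+1%:R * (n + 1) + 18)).
    by rewrite -expRM_natl -expRD; congr expR; rewrite -natr1; ring.
  apply: bourdon_ge (Hphi u) (Hphi v) _ => // N.
  by exists (j.+2 + N)%N, (j.+2 + N)%N; split; rewrite ?leq_addl//; exact: word_gromov_le.
- by rewrite expR_lt1; lra.
- rewrite /powR gt_eqF ?expR_gt0// expRK.
  apply: (@le_trans _ _ (expR (s * (n + 1)) * expR (s * - (n + 1)))).
    by rewrite mulrN expRxMexpNx_1.
  by rewrite ler_wpM2r// expR_ge0.
Qed.

End SchottkyCantorSet.

Section BishopJones.
Context {R : realType} (X : metricType R).
Hypotheses (X_proper : proper_space X) (X_cat : CAT_minus1 X).
Variables (Gam : set (isom X)) (x : X) (Gam_group : subgroup Gam).
Hypotheses (pos : (0 < critical_exponent Gam x)%E)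
  (fin : (critical_exponent Gam x < +oo)%E).

(** For 0 < s' < delta there is a Schottky set of at least exp(s' (n + 1))
    elements of length about n; the words in it give dimension at least s'. *)
Lemma critical_exponent_le_dim : nonelementary Gam x ->
  (critical_exponent Gam x <= hausdorff_dim (bourdon x) (limit_set Gam x))%E.
Proof.
move=> nonel.
have dE : critical_exponent Gam x = (fine (critical_exponent Gam x))%:E.
  by rewrite fineK// ge0_fin_numE// ltW.
have dim0 : (0 <= hausdorff_dim (bourdon x) (limit_set Gam x))%E.
  by apply: le_ereal_inf_tmp => _ [t [t0 _] <-]; rewrite lee_fin ltW.
apply/lee_subgt0Pr => e e0; rewrite dE -EFinB; set d := fine _ in dE *.
set s' := d - e; have [s'0|s'0] := leP s' 0.
  by apply: le_trans dim0; rewrite lee_fin.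
pose s := (s' + d) / 2.
have s's : s' < s by rewrite /s /s'; lra.
have sd : s < d by rewrite /s /s'; lra.
have s0 : 0 <= s by lra.
have div : ~ bounded_sums Gam (weight x s).
  move=> bs; have : (critical_exponent Gam x <= s%:E)%E.
    by apply: critical_exponent_le => //; lra.
  by rewrite dE lee_fin leNgt sd.
have [C [B [C0 BG Bdiv Bturn]]] :=
  divergent_transverse X_proper X_cat Gam_group pos fin nonel div s0.
have r0 : 0 <= 2 * C + 56 by lra.
have [n [S [n0 uS SB Ssep Sbig]]] := separated_annulus Gam_group fin
  (Num.truncn (2 * C + 40)).+1 BG s'0 s's r0 Bdiv.
have Cn : 2 * C + 40 <= n%:R.
  by apply: (le_trans (ltW (truncnS_gt _))); rewrite ler_nat.
pose a (i : 'I_(size S)) := nth 1%g S i.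
have aS i : a i \in S by exact: mem_nth.
apply: (@schottky_dim_ge _ _ X_cat X_proper Gam x Gam_group _ a C n%:R) => //.
- by move=> i; apply: BG; have [] := SB _ (aS i).
- by move=> i; have [] := SB _ (aS i).
- by move=> i j; apply: Bturn; [have [] := SB _ (aS i)|have [] := SB _ (aS j)].
- move=> i j ij; apply: Ssep => //; apply/negP => /eqP aij; apply: ij.
  by apply/val_inj/eqP; rewrite -(nth_uniq 1%g (ltn_ord i) (ltn_ord j) uS); exact/eqP.
- rewrite -(ltr_nat R); apply: lt_le_trans Sbig.
  by rewrite expR_gt1 mulr_gt0//; have := ler0n R n; lra.
Qed.

End BishopJones.

Theorem theorem10p4 (R : realType) (X : metricType R) (Gam : set (isom X)) (x : X)
    (X_proper : proper_space X) (X_cat : CAT_minus1 X)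
    (Gam_group : subgroup Gam) (Gam_countable : countable Gam)
    (Gam_discrete : discrete_subgroup Gam)
    (delta_gt0 : (0 < critical_exponent Gam x)%E)
    (delta_fin : (critical_exponent Gam x < +oo)%E)
    (T : hierarchy Gam) :
  let delta := fine (critical_exponent Gam x) in
  [/\ every_nonterminal_node
        (fun H D => forall (F : lifting D) (C : {set quoE D}),
          component F C -> has_cycle F C ->
          (forall e f, e \in C -> f \in C ->
             (transition_entry F x delta e f < +oo)%E) /\
          spectral_radius (transition_block F x C delta) <= 1) T,
      every_nonterminal_node
        (fun H D => forall (F : lifting D) (C : {set quoE D}),
          component F C -> has_cycle F C ->
          forall a : hyperbolic_choice F C,
            (critical_parameter x a <= critical_exponent Gam x)%E) T &
      [/\ finitely_generated Gam, nonelementary Gam x &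
          (critical_exponent Gam x < 1)%E] \/ convex_cobounded Gam x ->
      every_nonterminal_node
        (fun H D => forall (F : lifting D) (C : {set quoE D}),
          component F C -> has_cycle F C ->
          forall a : hyperbolic_choice F C,
            (critical_parameter x a
               <= hausdorff_dim (bourdon x) (limit_set Gam x))%E) T].
Proof.
move=> delta.
have dE : critical_exponent Gam x = delta%:E.
  by rewrite fineK// ge0_fin_numE// ltW.
have d0 : 0 < delta by rewrite -lte_fin -dE.
have crit s : delta < s -> bounded_sums Gam (weight x s).
  by move=> ds; apply: critical_exponent_lt; rewrite dE lte_fin.
have param (H : set (isom X)) (D : decomposition H) (F : lifting D)
    (C : {set quoE D}) (a : hyperbolic_choice F C) : subgroup H -> H `<=` Gam ->
    (critical_parameter x a <= critical_exponent Gam x)%E.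
  by move=> Hg HG; rewrite dE; exact: (critical_parameter_le X_cat d0 crit Hg HG).
split.
- apply: (every_nonterminal_node_sub (A := Gam) _ _ Gam_group) => // H D Hg HG F C Ccomp _.
  split; last exact: (transition_radius_le1 d0 crit Hg HG Ccomp).
  move=> e f eC fC; rewrite -(enum_rankK_in eC eC) -(enum_rankK_in fC fC).
  exact: (transition_entry_finite d0 crit Hg HG Ccomp).
- apply: (every_nonterminal_node_sub (A := Gam) _ _ Gam_group) => // H D Hg HG F C _ _ a.
  exact: param.
- move=> geom; have nonel : nonelementary Gam x by case: geom => [[]|[]].
  apply: (every_nonterminal_node_sub (A := Gam) _ _ Gam_group) => // H D Hg HG F C _ _ a.
  apply: le_trans (param H D F C a Hg HG) _.
  exact: critical_exponent_le_dim.
Qed.
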